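(* The limit of solutions of Teichmüller harmonic map flow as $t\to\infty$ can be non-unique, even after pull-back by diffeomorphisms. That is: there exist a closed oriented surface $M$ of genus at least $1$, a smooth closed target manifold $(N,g_N)$, a solution $(u(t),g(t))$, $t\in[0,\infty)$, of Teichmüller harmonic map flow from $M$ into $N$, sequences of times $t_i\to\infty$ and $\tilde t_i\to\infty$, and sequences of diffeomorphisms $\psi_i,\tilde\psi_i\colon M\to M$ such that $(u(t_i)\circ\psi_i,\psi_i^*g(t_i))$ and $(u(\tilde t_i)\circ\tilde\psi_i,\tilde\psi_i^*g(\tilde t_i))$ converge smoothly to limits $(u_\infty,g_\infty)$ and $(\tilde u_\infty,\tilde g_\infty)$ respectively, and there is no diffeomorphism $f\colon M\to M$ with $(\tilde u_\infty,\tilde g_\infty)=(u_\infty\circ f,f^*g_\infty)$.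
   Context: Teichmüller harmonic map flow: fix a parameter $\eta>0$. For a closed oriented surface $M$ of genus $\geq1$ let $\mathcal{M}_c$ be the space of smooth metrics on $M$ of constant curvature $c$, where $c=0$ for genus $1$ (with the additional restriction of unit area) and $c=-1$ for genus $\geq2$. For a map $u\colon M\to N$ and $g\in\mathcal{M}_c$ the Dirichlet energy is $E(u,g)=\frac12\int_M|du|_g^2\,dv_g$. The flow is its gradient flow $$\frac{\partial u}{\partial t}=\tau_g(u),\qquad \frac{\partial g}{\partial t}=\frac{\eta^2}{4}\mathrm{Re}\big(P_g(\Phi(u,g))\big),$$ where $\tau_g(u)=\mathrm{tr}_g\nabla du$ is the tension field, $\Phi(u,g)$ is the Hopf differential, i.e. $\Phi(u,g)=(|u_x|^2-|u_y|^2-2i\langle u_x,u_y\rangle)\,dz^2$ in local isothermal coordinates $z=x+iy$ of $(M,g)$, and $P_g$ is the $L^2(M,g)$-orthogonal projection from quadratic differentials onto the finite-dimensional space of holomorphic quadratic differentials on $(M,g)$. *)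

(* Defs.v *)
From HB Require Import structures.
From Stdlib Require Import Relation_Operators.
From mathcomp Require Import all_boot all_order all_algebra.
From mathcomp Require Import complex.
From mathcomp Require Import all_classical all_reals all_analysis.

Set Implicit Arguments.
Unset Strict Implicit.
Unset Printing Implicit Defensive.

Import Order.TTheory GRing.Theory Num.Theory.
Import numFieldNormedType.Exports.

Local Open Scope classical_set_scope.
Local Open Scope ring_scope.

Section Calculus.
Context {R : realType} {m : nat} {V : normedModType R}.
Implicit Types (f : 'rV[R]_m -> V).

Definition pd (i : 'I_m) f : 'rV[R]_m -> V := fun x => 'D_(delta_mx 0 i) f x.

Definition iter_pd (s : seq 'I_m) f : 'rV[R]_m -> V := foldr pd f s.

Definition smooth_on (U : set 'rV[R]_m) f : Prop :=
  forall s x, U x -> differentiable (iter_pd s f) x.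

End Calculus.

(* Smoothness at (t0, x0) of a function on [0, +oo[ x R^m, in the sense of
   functions on a set that need not be open: f has a smooth local extension.
   The point (t, x) is encoded as the row vector with head t and tail x. *)
Definition smooth_at_spacetime {R : realType} {m : nat} {V : normedModType R}
    (f : R -> 'rV[R]_m -> V) (t0 : R) (x0 : 'rV[R]_m) : Prop :=
  exists (W : set 'rV[R]_(1 + m)) (F : 'rV[R]_(1 + m) -> V),
    [/\ open W, W (row_mx t0%:M x0), smooth_on W F
      & forall t x, 0 <= t -> W (row_mx t%:M x) -> F (row_mx t%:M x) = f t x].

Definition has_time_derivative {R : realType} {V : normedModType R}
    (f : R -> V) (t : R) (l : V) : Prop :=
  (s - t)^-1 *: (f s - f t) @[s --> within [set s | 0 <= s] t^'] --> l.

(* A coordinate chart; [cmap] and [cinv] are only meaningful on [cdom] and on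
   its image respectively. *)
Record chart (R : realType) (M : topologicalType) (n : nat) := Chart {
  cdom : set M;
  cmap : M -> 'rV[R]_n;
  cinv : 'rV[R]_n -> M }.

Section Manifolds.
Context {R : realType}.

Definition cimg (M : topologicalType) n (c : chart R M n) : set 'rV[R]_n :=
  cmap c @` cdom c.

Definition is_chart (M : topologicalType) n (c : chart R M n) : Prop :=
  [/\ open (cdom c), open (cimg c),
      {within cdom c, continuous (cmap c)},
      {within cimg c, continuous (cinv c)}
    & forall p, cdom c p -> cinv c (cmap c p) = p].

(* Expression in the charts c and d of a map between manifolds. *)
Definition in_charts (M N : topologicalType) m n (c : chart R M m)
    (d : chart R N n) (f : M -> N) : 'rV[R]_m -> 'rV[R]_n :=
  fun x => cmap d (f (cinv c x)).

(* Jacobian at p of f in the charts c and d.  The library acts on row vectors,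
   so that the (i, j) entry is the i-th partial derivative of component j. *)
Definition jac (M N : topologicalType) m n (c : chart R M m)
    (d : chart R N n) (f : M -> N) (p : M) : 'M[R]_(m, n) :=
  'J (in_charts c d f) (cmap c p).

Definition compatible (M : topologicalType) n (c d : chart R M n) : Prop :=
  smooth_on (cmap c @` (cdom c `&` cdom d)) (in_charts c d id).

Definition same_orientation (M : topologicalType) n (c d : chart R M n) : Prop :=
  forall p, cdom c p -> cdom d p -> 0 < \det (jac c d id p).

Definition smooth_atlas (M : topologicalType) n (A : set (chart R M n)) : Prop :=
  [/\ forall c, A c -> is_chart c,
      forall p, exists2 c, A c & cdom c p
    & forall c d, A c -> A d -> compatible c d].

Definition oriented_atlas (M : topologicalType) n (A : set (chart R M n)) : Prop :=
  smooth_atlas A /\ (forall c d, A c -> A d -> same_orientation c d).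

(* The maximal smooth atlas, and the maximal oriented one, generated by A. *)
Definition smooth_chart (M : topologicalType) n (A : set (chart R M n))
    (c : chart R M n) : Prop :=
  is_chart c /\ (forall d, A d -> compatible c d /\ compatible d c).

Definition oriented_chart (M : topologicalType) n (A : set (chart R M n))
    (c : chart R M n) : Prop :=
  smooth_chart A c /\ (forall d, A d -> same_orientation c d).

Definition closed_manifold (M : topologicalType) n (A : set (chart R M n)) : Prop :=
  [/\ hausdorff_space M, compact [set: M] & smooth_atlas A].

Definition smooth_map (M N : topologicalType) m n (A : set (chart R M m))
    (B : set (chart R N n)) (f : M -> N) : Prop :=
  continuous f /\
  forall c d p, A c -> B d -> cdom c p -> cdom d (f p) ->
    exists W : set 'rV[R]_m,
      [/\ open W, W (cmap c p) & smooth_on W (in_charts c d f)].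

Definition diffeomorphism (M : topologicalType) n (A : set (chart R M n))
    (f : M -> M) : Prop :=
  exists f' : M -> M,
    [/\ cancel f f', cancel f' f, smooth_map A A f & smooth_map A A f'].

(* A covariant 2-tensor field is given by its matrices of components in all
   charts of the maximal atlas. *)
Definition tensor (M : topologicalType) n := chart R M n -> M -> 'M[R]_n.

(* k = f^* h *)
Definition is_pullback (M N : topologicalType) m n (A : set (chart R M m))
    (B : set (chart R N n)) (f : M -> N) (h : tensor N n) (k : tensor M m) : Prop :=
  forall c d p, smooth_chart A c -> smooth_chart B d ->
    cdom c p -> cdom d (f p) ->
    k c p = jac c d f p *m h d (f p) *m (jac c d f p)^T.

Definition local (M : topologicalType) n (g : tensor M n) (c : chart R M n) :
    'rV[R]_n -> 'M[R]_n :=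
  fun x => g c (cinv c x).

Definition pos_def n (G : 'M[R]_n) : Prop :=
  G^T = G /\ (forall v : 'rV[R]_n, v != 0 -> 0 < (v *m G *m v^T) 0 0).

(* [is_pullback A A id g g] is the tensor transformation law under changes of
   coordinates. *)
Definition riemannian_metric (M : topologicalType) n (A : set (chart R M n))
    (g : tensor M n) : Prop :=
  [/\ is_pullback A A id g g,
      forall c p, smooth_chart A c -> cdom c p -> pos_def (g c p)
    & forall c, A c -> smooth_on (cimg c) (local g c)].

(* [christoffel G k i j] is the symbol with upper index k. *)
Definition christoffel n (G : 'rV[R]_n -> 'M[R]_n) (k i j : 'I_n)
    (x : 'rV[R]_n) : R :=
  2^-1 * \sum_l invmx (G x) k l *
    (pd i (fun y => G y j l) x + pd j (fun y => G y i l) x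
     - pd l (fun y => G y i j) x).

(* <R(e0,e1)e1, e0> / det G for the coordinate frame e0, e1. *)
Definition gauss_curvature (G : 'rV[R]_2 -> 'M[R]_2) (x : 'rV[R]_2) : R :=
  let Ga := christoffel G in
  (\sum_l G x l 0 *
     (pd 0 (Ga l 1 1) x - pd 1 (Ga l 0 1) x
      + \sum_k (Ga k 1 1 x * Ga l 0 k x - Ga k 0 1 x * Ga l 1 k x)))
  / \det (G x).

Definition tension m n (G : 'rV[R]_m -> 'M[R]_m) (H : 'rV[R]_n -> 'M[R]_n)
    (v : 'rV[R]_m -> 'rV[R]_n) (x : 'rV[R]_m) : 'rV[R]_n :=
  \row_a \sum_i \sum_j invmx (G x) i j *
    (pd i (pd j (fun y => v y 0 a)) x
     - \sum_k christoffel G k i j x * pd k (fun y => v y 0 a) x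
     + \sum_b \sum_c christoffel H a b c (v x) *
         pd i (fun y => v y 0 b) x * pd j (fun y => v y 0 c) x).

Definition smooth_cvg_map (M N : topologicalType) m n (A : set (chart R M m))
    (B : set (chart R N n)) (v : nat -> M -> N) (w : M -> N) : Prop :=
  forall c d (K : set M), A c -> B d -> compact K ->
    K `<=` cdom c -> w @` K `<=` cdom d ->
    (\forall i \near \oo, v i @` K `<=` cdom d) /\
    (forall s (e : R), 0 < e -> \forall i \near \oo, forall p, K p ->
       `|iter_pd s (in_charts c d (v i)) (cmap c p)
         - iter_pd s (in_charts c d w) (cmap c p)| < e).

Definition smooth_cvg_tensor (M : topologicalType) n (A : set (chart R M n))
    (h : nat -> tensor M n) (k : tensor M n) : Prop :=
  forall c (K : set M), A c -> compact K -> K `<=` cdom c ->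
    forall s (e : R), 0 < e -> \forall i \near \oo, forall p, K p ->
      `|iter_pd s (local (h i) c) (cmap c p)
        - iter_pd s (local k c) (cmap c p)| < e.

Definition row2 (a b : R) : 'rV[R]_2 := \row_j (if j == 0 then a else b).

(* Vertices, sides and convex hull of the regular 4 gamma-gon. *)
Definition vertex (gamma j : nat) : 'rV[R]_2 :=
  let a : R := 2 * pi * j%:R / (4 * gamma)%:R in row2 (cos a) (sin a).

Definition side (gamma j : nat) (r : R) : 'rV[R]_2 :=
  (1 - r) *: vertex gamma j + r *: vertex gamma j.+1.

Definition polygon (gamma : nat) : set 'rV[R]_2 :=
  [set x | exists w : 'I_(4 * gamma) -> R,
     [/\ forall j, 0 <= w j, \sum_j w j = 1
       & x = \sum_j w j *: vertex gamma j]].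

(* The side pairing given by the word
   a_1 b_1 a_1^-1 b_1^-1 ... a_gamma b_gamma a_gamma^-1 b_gamma^-1. *)
Inductive side_pairing (gamma : nat) : 'rV[R]_2 -> 'rV[R]_2 -> Prop :=
| pair_a (k : nat) (r : R) : (k < gamma)%N -> 0 <= r <= 1 ->
    side_pairing gamma (side gamma (4 * k) r) (side gamma (4 * k + 2) (1 - r))
| pair_b (k : nat) (r : R) : (k < gamma)%N -> 0 <= r <= 1 ->
    side_pairing gamma (side gamma (4 * k + 1) r) (side gamma (4 * k + 3) (1 - r)).

(* For a compact Hausdorff M: M is homeomorphic to the quotient of the
   4 gamma-gon by the side pairing, the standard surface of genus gamma >= 1. *)
Definition has_genus (M : topologicalType) (gamma : nat) : Prop :=
  (0 < gamma)%N /\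
  exists q : 'rV[R]_2 -> M,
    [/\ {within polygon gamma, continuous q},
        q @` polygon gamma = [set: M]
      & forall x y, polygon gamma x -> polygon gamma y ->
          (q x = q y <-> clos_refl_sym_trans _ (side_pairing gamma) x y)].

Definition closed_oriented_surface (M : topologicalType) (A : set (chart R M 2))
    (gamma : nat) : Prop :=
  [/\ closed_manifold A, oriented_atlas A, connected [set: M]
    & has_genus M gamma].

Definition borel (M : ptopologicalType) := g_sigma_algebraType (@open M).

(* mu is the Riemannian area measure dv_g: it has density sqrt (det g) with
   respect to Lebesgue measure in each chart of the atlas.  By the change of
   variables formula the same then holds in all smooth charts. *)
Definition is_area (M : ptopologicalType) (A : set (chart R M 2))
    (g : tensor M 2) (mu : {measure set (borel M) -> \bar R}) : Prop :=
  forall c (B : set (borel M)), A c -> measurable B -> B `<=` cdom c ->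
    mu B = (\int[lebesgue_measure \x lebesgue_measure]_(z in
              [set z : R * R | (cmap c @` B) (row2 z.1 z.2)])
              (Num.sqrt (\det (local g c (row2 z.1 z.2))))%:E)%E.

Definition in_Mc (M : ptopologicalType) (A : set (chart R M 2)) (gamma : nat)
    (g : tensor M 2) : Prop :=
  [/\ riemannian_metric A g,
      forall c p, A c -> cdom c p ->
        gauss_curvature (local g c) (cmap c p) = (if gamma == 1%N then 0 else -1)
    & gamma = 1%N ->
        exists mu, is_area A g mu /\ mu [set: M] = 1%E].

Definition isothermal (M : topologicalType) (A : set (chart R M 2))
    (g : tensor M 2) (c : chart R M 2) : Prop :=
  oriented_chart A c /\
  (forall p, cdom c p -> g c p = (g c p 0 0)%:M).

(* A quadratic differential psi dz^2 on (M, g) is given by its coefficients psi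
   in all isothermal charts z = x + i y. *)
Definition qdiff (M : topologicalType) := chart R M 2 -> M -> R[i].

(* dw/dz for a holomorphic change of isothermal coordinates z -> w. *)
Definition cderiv (M : topologicalType) (c d : chart R M 2) (p : M) : R[i] :=
  Complex (jac c d id p 0 0) (jac c d id p 0 1).

Definition is_qdiff (M : topologicalType) (A : set (chart R M 2))
    (g : tensor M 2) (q : qdiff M) : Prop :=
  forall c d p, isothermal A g c -> isothermal A g d -> cdom c p -> cdom d p ->
    q c p = q d p * cderiv c d p ^+ 2.

(* Holomorphic functions of z = x + i y: real differentiability together with
   the Cauchy-Riemann equations. *)
Definition holomorphic_at (f : 'rV[R]_2 -> R[i]) (x : 'rV[R]_2) : Prop :=
  let a y := complex.Re (f y) in let b y := complex.Im (f y) in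
  [/\ differentiable a x, differentiable b x,
      pd 0 a x = pd 1 b x & pd 1 a x = - pd 0 b x].

Definition holomorphic_qdiff (M : topologicalType) (A : set (chart R M 2))
    (g : tensor M 2) (q : qdiff M) : Prop :=
  is_qdiff A g q /\
  (forall c p, isothermal A g c -> cdom c p ->
     holomorphic_at (fun x => q c (cinv c x)) (cmap c p)).

(* F is the pointwise hermitian product <q, r>_g; for g = rho^2 |dz|^2 one has
   |dz^2|^2 = 4 rho^-4. *)
Definition is_pointwise_product (M : topologicalType) (A : set (chart R M 2))
    (g : tensor M 2) (q r : qdiff M) (F : M -> R[i]) : Prop :=
  forall c p, isothermal A g c -> cdom c p ->
    F p = (4 / (g c p 0 0) ^+ 2)%:C%C * (q c p * (r c p)^*%C).

Definition L2_orthogonal (M : ptopologicalType) (A : set (chart R M 2))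
    (g : tensor M 2) (q r : qdiff M) : Prop :=
  exists (mu : {measure set (borel M) -> \bar R}) (F : M -> R[i]),
    [/\ is_area A g mu, is_pointwise_product A g q r F,
        (\int[mu]_p (complex.Re (F p))%:E = 0)%E
      & (\int[mu]_p (complex.Im (F p))%:E = 0)%E].

(* q = P_g (phi) *)
Definition is_projection (M : ptopologicalType) (A : set (chart R M 2))
    (g : tensor M 2) (phi q : qdiff M) : Prop :=
  holomorphic_qdiff A g q /\
  (forall r, holomorphic_qdiff A g r ->
     L2_orthogonal A g (fun c p => phi c p - q c p) r).

Definition is_hopf (M N : topologicalType) n (A : set (chart R M 2))
    (B : set (chart R N n)) (h : tensor N n) (u : M -> N) (g : tensor M 2)
    (phi : qdiff M) : Prop :=
  forall c d p, isothermal A g c -> B d -> cdom c p -> cdom d (u p) ->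
    let ux := row 0 (jac c d u p) in
    let uy := row 1 (jac c d u p) in
    let prod v w : R := (v *m h d (u p) *m w^T) 0 0 in
    phi c p = Complex (prod ux ux - prod uy uy) (- (2 * prod ux uy)).

(* The matrix of Re (psi dz^2) in the coordinates z = x + i y. *)
Definition re_dz2 (psi : R[i]) : 'M[R]_2 :=
  let a := complex.Re psi in let b := complex.Im psi in
  \matrix_(i, j) (if i == j then (if i == 0 then a else - a) else - b).

Definition smooth_flow (M N : topologicalType) n (A : set (chart R M 2))
    (B : set (chart R N n)) (u : R -> M -> N) (g : R -> tensor M 2) : Prop :=
  [/\ {within [set z : R * M | 0 <= z.1], continuous (fun z => u z.1 z.2)},
      forall t c d p, 0 <= t -> A c -> B d -> cdom c p -> cdom d (u t p) ->
        smooth_at_spacetime (fun s => in_charts c d (u s)) t (cmap c p)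
    & forall t c p, 0 <= t -> A c -> cdom c p ->
        smooth_at_spacetime (fun s => local (g s) c) t (cmap c p)].

(* (u, g) is a smooth solution on [0, +oo[ with coupling constant eta.  In the
   equation for g, the chart c is isothermal at the time t considered, and is
   kept fixed in the time derivative. *)
Definition teichmuller_flow (eta : R) (M : ptopologicalType) (N : topologicalType)
    n (A : set (chart R M 2)) (gamma : nat) (B : set (chart R N n))
    (h : tensor N n) (u : R -> M -> N) (g : R -> tensor M 2) : Prop :=
  [/\ smooth_flow A B u g,
      forall t, 0 <= t -> in_Mc A gamma (g t),
      forall t c d p, 0 <= t -> A c -> B d -> cdom c p -> cdom d (u t p) ->
        has_time_derivative (fun s => cmap d (u s p)) t
          (tension (local (g t) c) (local h d) (in_charts c d (u t)) (cmap c p))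
    & forall t, 0 <= t -> exists phi q : qdiff M,
        [/\ is_hopf A B h (u t) (g t) phi,
            is_projection A (g t) phi q
          & forall c p, isothermal A (g t) c -> cdom c p ->
              has_time_derivative (fun s => g s c p) t
                ((eta ^+ 2 / 4) *: re_dz2 (q c p))]].

(* For times ti -> +oo and diffeomorphisms psi_i, the pairs
   (u(t_i) o psi_i, psi_i^* g(t_i)) converge smoothly to (uoo, goo). *)
Definition limit_along (M : ptopologicalType) (N : topologicalType) n
    (A : set (chart R M 2)) (gamma : nat) (B : set (chart R N n))
    (u : R -> M -> N) (g : R -> tensor M 2)
    (ti : nat -> R) (psi : nat -> M -> M) (uoo : M -> N) (goo : tensor M 2) : Prop :=
  [/\ (forall i, 0 <= ti i) /\ ti @ \oo --> +oo,
      forall i, diffeomorphism A (psi i),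
      smooth_map A B uoo /\ in_Mc A gamma goo,
      smooth_cvg_map A B (fun i => u (ti i) \o psi i) uoo
    & exists2 k : nat -> tensor M 2,
        forall i, is_pullback A A (psi i) (g (ti i)) (k i)
        & smooth_cvg_tensor A k goo].

End Manifolds.

(* Main.v *)
From HB Require Import structures.
Require Import Defs.
From Stdlib Require Import Relation_Operators.
From mathcomp Require Import all_boot all_order all_algebra.
From mathcomp Require Import complex.
From mathcomp Require Import all_classical all_reals all_analysis.
From mathcomp Require Import measurable_realfun.
From mathcomp Require Import ring lra.

Set Implicit Arguments.
Unset Strict Implicit.
Unset Printing Implicit Defensive.

Import Order.TTheory GRing.Theory Num.Theory.
Import numFieldNormedType.Exports.
Local Open Scope classical_set_scope.
Local Open Scope ring_scope.

(** The flow is realised as a gradient flow on a two-dimensional torus. The domain is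
    the flat unit square torus M, and the target is the four-dimensional torus
    M x Z, where Z is a torus with coordinates (x, y), with the metric
      (1 + F) (flat metric of M) + 4 pi^2 (1 - Y^4) dx^2 + dy^2.
    Here F is a nonnegative function on Z, and Y is a function of y of period one that
    equals y for y between -1/4 and 1/4.

    Consider the slices u(p) = (p, z) with z in Z. Such a map is homothetic, so its
    Hopf differential vanishes [slice_hopf] and the metric on M does not move. The
    tension field of u is tangent to Z and equals minus the gradient of F at z: the
    Christoffel symbols of the warped product give half of it for each of the two
    directions of M [christoffel_warped], [tension_incl]. Hence (p, z(t)) with the
    constant metric solves the flow as soon as z(t) is a gradient line of - F.

    It remains to find F with a gradient line that does not converge. Gradient lines of
    analytic functions on a compact manifold converge, so F has to be flat somewhere: it is
      F = exp(-1/Y) (1 - (1 - Y^4) sin(2 pi x - 1/Y))  for Y > 0, and 0 for Y <= 0.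
    On the curve 2 pi x = 1/y the sine vanishes, and the coefficient 1 - Y^4 is such that
    the gradient of F is tangent to the curve [potential_dx], [potential_dy]. The curve is
    then a gradient line, with the explicit parametrisation theta = 1/y = ln(t + e^5)
    [isD_clock]: it spirals around the circle y = 0 for ever, since x = theta/(2 pi). At
    the times where x is an integer the maps converge to the slice through (0, 0), and at
    those where x is a half-integer to the slice through (1/2, 0), with the identity as
    diffeomorphism [flow_limit]. These two limits have disjoint images, so no
    reparametrisation of M relates them [slice_inj_mod].

    The smoothness of F rests on the family of flat functions stable under
    differentiation [isD_flat]. The tori are quotients of vector spaces; their charts
    differ by integer translations, so that all maps in play are affine in charts
    [near_lift] and constant tensors are tensors [invariant_tensor_pullback]. The area
    of the flat torus is Lebesgue measure on a fundamental square [torus_area], and the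
    genus is read off from the square with paired sides [torus_genus]. *)

(** * Smooth functions of several variables *)

Section Smooth.
Context {R : realType} {m : nat}.
Implicit Types (U : set 'rV[R]_m) (s : seq 'I_m) (x : 'rV[R]_m).

Lemma near_pd (V : normedModType R) (f g : 'rV[R]_m -> V) x i :
  {near x, f =1 g} -> {near x, pd i f =1 pd i g}.
Proof.
by move=> /near_join; apply: filterS => y fg; apply: near_eq_derive.
Qed.

Lemma near_iter_pd (V : normedModType R) (f g : 'rV[R]_m -> V) x s :
  {near x, f =1 g} -> {near x, iter_pd s f =1 iter_pd s g}.
Proof. by move=> fg; elim: s => //= i s; apply: near_pd. Qed.

(** The difference of the two functions vanishes near [x], hence has zero
    differential there. *)
Lemma near_differentiable (V : normedModType R) (f g : 'rV[R]_m -> V) x :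
  {near x, f =1 g} -> differentiable f x -> differentiable g x.
Proof.
move=> fg df; have -> : g = f + (g - f) by rewrite addrC subrK.
apply: differentiableD => //.
have h0 : {near x, g - f =1 (fun=> 0)}.
  by apply: filterS fg => y fgy /=; rewrite !fctE fgy subrr.
have hx0 : (g - f) x = 0 by apply: (nbhs_singleton h0).
have z0 : continuous (\0 : 'rV[R]_m -> V) by move=> z; apply: cst_continuous.
have key : (g - f) \o shift x = cst ((g - f) x) + (\0 : 'rV[R]_m ->
  V) +o_ (0 : 'rV[R]_m) id.
  apply/eqaddoP => e e0.
  move: h0; rewrite (near_shift (0 : 'rV[R]_m)) => h0.
  apply: filterS h0 => z /=; rewrite subr0 => hz.
  rewrite !fctE /= in hz hx0 *.
  rewrite hx0 hz !addr0 subrr normr0 mulr_ge0 //; exact: ltW.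
apply/diff_locallyP.
by rewrite (@diff_unique _ _ _ _ (\0 : {linear 'rV[R]_m -> V}) x z0).
Qed.

(** Partial derivatives are peeled from the inner end of the list, so that
    smoothness is stable under each [pd i]; the finite order version below turns
    this into an induction on the order. *)
Lemma smooth_onS (V : normedModType R) U (f : 'rV[R]_m -> V) :
  smooth_on U f <->
  (forall x, U x -> differentiable f x) /\ (forall i, smooth_on U (pd i f)).
Proof.
split=> [sf|[df sf]].
  split=> [x Ux|i s x Ux]; first exact: (sf [::] x).
  by have := sf (rcons s i) x Ux; rewrite /iter_pd foldr_rcons.
by move=> s; case/lastP: s => // s i x Ux; rewrite /iter_pd foldr_rcons; apply: sf.
Qed.

(** Smoothness is local, and the local models may be defined on different open sets:
    this is how functions given through integer parts are handled. *)
Lemma near_smooth_on (V : normedModType R) U (f : 'rV[R]_m -> V) :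
  (forall x, U x -> exists (W : set 'rV[R]_m) g, [/\ smooth_on W g, W x & {near x,
    f =1 g}]) ->
  smooth_on U f.
Proof.
move=> H s x /H [W [g [sg Wx fg]]].
by apply: near_differentiable (sg s x Wx); apply: near_iter_pd; apply: filterS fg.
Qed.

Lemma eq_smooth_on (V : normedModType R) U (f g : 'rV[R]_m -> V) :
  open U -> {in U, f =1 g} -> smooth_on U f -> smooth_on U g.
Proof.
move=> oU fg sf; apply: near_smooth_on => x Ux; exists U, f; split => //.
have := open_nbhs_nbhs (conj oU Ux); apply: filterS => y Uy.
by rewrite fg // inE.
Qed.

Definition smooth_upto (V : normedModType R) k U (f : 'rV[R]_m -> V) :=
  forall s, (size s <= k)%N -> forall x, U x -> differentiable (iter_pd s f) x.

Lemma smooth_on_upto (V : normedModType R) U (f : 'rV[R]_m -> V) :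
  smooth_on U f <-> forall k, smooth_upto k U f.
Proof. by split=> [sf k s _|sf s]; [apply: sf|apply: (sf (size s))]. Qed.

Lemma smooth_uptoS (V : normedModType R) k U (f : 'rV[R]_m -> V) :
  smooth_upto k.+1 U f <->
  (forall x, U x -> differentiable f x) /\ (forall i, smooth_upto k U (pd i f)).
Proof.
split=> [sf|[df sf]].
  split=> [x Ux|i s ks x Ux]; first exact: (sf [::]).
  by have := sf (rcons s i); rewrite size_rcons /iter_pd foldr_rcons; apply.
move=> s; case/lastP: s => // s i; rewrite size_rcons ltnS => ks x Ux.
by rewrite /iter_pd foldr_rcons; apply: sf.
Qed.

Lemma smooth_uptoW (V : normedModType R) k U (f : 'rV[R]_m -> V) :
  smooth_upto k.+1 U f -> smooth_upto k U f.
Proof. by move=> sf s ks; apply: sf; apply: leqW. Qed.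

Lemma eq_smooth_upto (V : normedModType R) k U (f g : 'rV[R]_m -> V) :
  open U -> {in U, f =1 g} -> smooth_upto k U f -> smooth_upto k U g.
Proof.
move=> oU fg sf s ks x Ux; apply: near_differentiable (sf s ks x Ux).
apply: near_iter_pd; have := open_nbhs_nbhs (conj oU Ux).
by apply: filterS => y Uy; rewrite fg // inE.
Qed.

Lemma smooth_upto_cst (V : normedModType R) k U (a : V) : smooth_upto k U (cst a).
Proof.
elim: k a => [|k IH] a; first by move=> [|//] _ x _ /=; apply: differentiable_cst.
apply/smooth_uptoS; split=> [x _|i]; first exact: differentiable_cst.
rewrite (_ : pd i (cst a) = cst 0) //.
by apply/funext => x; rewrite /pd derive_cst.
Qed.

Lemma smooth_uptoD (V : normedModType R) k U (f g : 'rV[R]_m -> V) : open U ->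
  smooth_upto k U f -> smooth_upto k U g -> smooth_upto k U (fun x => f x + g x).
Proof.
move=> oU; elim: k f g => [|k IH] f g sf sg.
  move=> [|//] _ x Ux /=; apply: (differentiableD (f := f) (g := g)).
    exact: (sf [::]).
  exact: (sg [::]).
move: sf sg => /smooth_uptoS [df sf] /smooth_uptoS [dg sg].
apply/smooth_uptoS; split=> [x Ux|i].
  by apply: (differentiableD (f := f) (g := g)); [apply: df|apply: dg].
apply: (@eq_smooth_upto _ k U (fun x => pd i f x + pd i g x)) => //.
  move=> x; rewrite inE => Ux; rewrite /pd; apply/esym.
  by apply: deriveD; apply: diff_derivable; [apply: df|apply: dg].
exact: IH.
Qed.

(** By Leibniz' rule a derivative of the product involves the factors themselves,
    whence the induction needs them up to the same order as their derivatives. *)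
Lemma smooth_uptoM k U (f g : 'rV[R]_m -> R) : open U ->
  smooth_upto k U f -> smooth_upto k U g -> smooth_upto k U (fun x => f x * g x).
Proof.
move=> oU; elim: k f g => [|k IH] f g sf sg.
  move=> [|//] _ x Ux /=; apply: (differentiableM (f := f) (g := g)).
    exact: (sf [::]).
  exact: (sg [::]).
have wf := smooth_uptoW sf; have wg := smooth_uptoW sg.
move: sf sg => /smooth_uptoS [df sf] /smooth_uptoS [dg sg].
apply/smooth_uptoS; split=> [x Ux|i].
  by apply: (differentiableM (f := f) (g := g)); [apply: df|apply: dg].
apply: (@eq_smooth_upto _ k U (fun x => f x * pd i g x + g x * pd i f x)) => //.
  move=> x; rewrite inE => Ux; rewrite /pd; apply/esym.
  by apply: deriveM; apply: diff_derivable; [apply: df|apply: dg].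
by apply: smooth_uptoD => //; apply: IH.
Qed.

Lemma smooth_uptoZl (V : normedModType R) k U (f : 'rV[R]_m -> R) (v : V) : open U ->
  smooth_upto k U f -> smooth_upto k U (fun x => f x *: v).
Proof.
move=> oU; elim: k f => [|k IH] f sf.
  move=> [|//] _ x Ux /=; apply: differentiableZl; exact: (sf [::]).
move: sf => /smooth_uptoS [df sf].
apply/smooth_uptoS; split=> [x Ux|i]; first by apply: differentiableZl; apply: df.
apply: (@eq_smooth_upto _ k U (fun x => pd i f x *: v)) => //; last exact: IH.
move=> x; rewrite inE => Ux; have dfx := df x Ux.
rewrite /pd !deriveE ?diffZl //; exact: differentiableZl.
Qed.

Lemma smooth_on_cst (V : normedModType R) U (a : V) : smooth_on U (cst a).
Proof. by apply/smooth_on_upto => k; apply: smooth_upto_cst. Qed.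

Lemma smooth_onD (V : normedModType R) U (f g : 'rV[R]_m -> V) : open U ->
  smooth_on U f -> smooth_on U g -> smooth_on U (fun x => f x + g x).
Proof.
move=> oU /smooth_on_upto sf /smooth_on_upto sg.
by apply/smooth_on_upto => k; apply: smooth_uptoD.
Qed.

Lemma smooth_onM U (f g : 'rV[R]_m -> R) : open U ->
  smooth_on U f -> smooth_on U g -> smooth_on U (fun x => f x * g x).
Proof.
move=> oU /smooth_on_upto sf /smooth_on_upto sg.
by apply/smooth_on_upto => k; apply: smooth_uptoM.
Qed.

Lemma smooth_onZl (V : normedModType R) U (f : 'rV[R]_m -> R) (v : V) : open U ->
  smooth_on U f -> smooth_on U (fun x => f x *: v).
Proof.
move=> oU /smooth_on_upto sf.
by apply/smooth_on_upto => k; apply: smooth_uptoZl.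
Qed.

Lemma smooth_onN U (f : 'rV[R]_m -> R) : open U ->
  smooth_on U f -> smooth_on U (fun x => - f x).
Proof.
move=> oU sf; under eq_fun do rewrite -mulN1r.
by apply: (@smooth_onM U (cst (-1))) => //; apply: smooth_on_cst.
Qed.

Lemma smooth_onB U (f g : 'rV[R]_m -> R) : open U ->
  smooth_on U f -> smooth_on U g -> smooth_on U (fun x => f x - g x).
Proof. by move=> oU sf sg; apply: smooth_onD => //; apply: smooth_onN. Qed.

Lemma smooth_onX U (f : 'rV[R]_m -> R) n : open U ->
  smooth_on U f -> smooth_on U (fun x => f x ^+ n).
Proof.
move=> oU sf; elim: n => [|n IH]; first by apply: (@smooth_on_cst _ U (1 : R)).
by under eq_fun do rewrite exprS; apply: smooth_onM.
Qed.

Lemma smooth_on_mx U p q (f : 'rV[R]_m -> 'M[R]_(p, q)) : open U ->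
  (forall i j, smooth_on U (fun x => f x i j)) -> smooth_on U f.
Proof.
move=> oU sf.
have -> : f = fun x => \sum_(ij : 'I_p * 'I_q) f x ij.1 ij.2 *: delta_mx ij.1 ij.2.
  by apply/funext => x; rewrite {1}(matrix_sum_delta (f x)) pair_big.
elim: (index_enum _) => [|ij r IH].
  under eq_fun do rewrite big_nil; exact: smooth_on_cst.
by under eq_fun do rewrite big_cons; apply: smooth_onD => //; apply: smooth_onZl.
Qed.

Lemma smooth_on_coord U i : smooth_on U (fun x => x 0 i : R).
Proof.
apply/smooth_onS; split=> [x _|j]; first exact: differentiable_coord.
rewrite (_ : pd j _ = cst ((delta_mx 0 j : 'rV[R]_m) 0 i)); first exact: smooth_on_cst.
apply/funext => x; rewrite /pd.
have dx : derivable (id : 'rV[R]_m -> 'rV[R]_m) x (delta_mx 0 j) by apply: derivable_id.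
have := @derive_mx R _ 1 m id x (delta_mx 0 j) dx.
by rewrite derive_id => /matrixP/(_ 0 i); rewrite [in RHS]mxE => H; rewrite /= H.
Qed.

(** Smoothness in one variable is witnessed by a family of functions stable under
    differentiation: such a family is usually visible at once (trigonometric
    functions, negative powers), which spares computing the n-th derivative. *)
Definition smooth1 (I : set R) (f : R -> R) :=
  exists2 S : set (R -> R), S f & forall g, S g ->
    exists2 g' : R -> R, S g' & forall t, I t -> is_derive t 1 g (g' t).

(** By the chain rule a partial derivative of [f (g x)] is [f' (g x)] times a partial
    derivative of [g], with [f'] in the same family as [f]; so the induction on the
    order runs over the whole family at once. *)
Lemma smooth_on_comp U I (f : R -> R) (g : 'rV[R]_m -> R) : open U ->
  smooth1 I f -> smooth_on U g -> (forall x, U x -> I (g x)) ->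
  smooth_on U (fun x => f (g x)).
Proof.
move=> oU [S Sf HS] sg gI; apply/smooth_on_upto => k.
elim: k f Sf => [|k IH] f Sf; have [f' Sf' Hf] := HS f Sf.
  move=> [|//] _ x Ux; apply: (differentiable_comp (f := g) (g := f));
    first exact: (sg [::]).
  by apply/derivable1_diffP; have [] := Hf _ (gI x Ux).
have dg x : U x -> differentiable g x by exact: (sg [::]).
have df x : U x -> differentiable f (g x).
  by move=> Ux; apply/derivable1_diffP; have [] := Hf _ (gI x Ux).
apply/smooth_uptoS; split=> [x Ux|i].
  by apply: (differentiable_comp (f := g) (g := f)); [apply: dg|apply: df].
apply: (@eq_smooth_upto _ k U (fun x => f' (g x) * pd i g x)) => //.
  move=> x; rewrite inE => Ux; rewrite /pd.
  have dgx := dg x Ux; have dfx := df x Ux.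
  rewrite [RHS]deriveE; last exact: (differentiable_comp (f := g) (g := f)).
  rewrite (diff_comp (f := g) (g := f)) //= deriveE //.
  have <- : 'd f (g x) 1 = f' (g x).
    by have [_ <-] := Hf _ (gI x Ux); rewrite [RHS]deriveE.
  have dl r : 'd f (g x) r = r * 'd f (g x) 1 by rewrite -{1}[r]mulr1 [LHS]linearZ.
  by rewrite [RHS]dl mulrC.
apply: (@smooth_uptoM k U (fun x => f' (g x)) (pd i g)) => //; first exact: IH.
by move/smooth_onS : sg => [_ /(_ i)/smooth_on_upto].
Qed.
End Smooth.

(** * Derivatives in one variable *)

Section Calculus1.
Context {R : realType}.
Implicit Types (f g : R -> R) (x a b : R).

(** The relation [is_derive _ 1] under a name that is not a class: derivatives are
    then computed by applying the rules below, never by instance search. *)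
Definition isD f x a : Prop := is_derive x 1 f a.

Lemma isD_eq f x a b : isD f x a -> a = b -> isD f x b.
Proof. by move=> H <-. Qed.

Lemma isDD f g x a b : isD f x a -> isD g x b -> isD (fun t => f t + g t) x (a + b).
Proof. exact: is_deriveD. Qed.

Lemma isDB f g x a b : isD f x a -> isD g x b -> isD (fun t => f t - g t) x (a - b).
Proof. exact: is_deriveB. Qed.

Lemma isDN f x a : isD f x a -> isD (fun t => - f t) x (- a).
Proof. exact: is_deriveN. Qed.

Lemma isDM f g x a b : isD f x a -> isD g x b ->
  isD (fun t => f t * g t) x (a * g x + f x * b).
Proof.
move=> df dg; apply: is_derive_eq (is_deriveM df dg) _.
by rewrite addrC mulrC.
Qed.

Lemma isD_comp f g x a b : isD f (g x) a -> isD g x b -> isD (fun t => f (g t)) x (a * b).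
Proof. exact: is_derive1_comp. Qed.

Lemma isDX f n x a : isD f x a -> isD (fun t => f t ^+ n) x (n%:R * f x ^+ n.-1 * a).
Proof.
move=> df; have -> : (fun t => f t ^+ n) = f ^+ n by apply/funext => t; rewrite exprfctE.
exact: is_deriveX.
Qed.

Lemma isDV f x a : f x != 0 -> isD f x a -> isD (fun t => (f t)^-1) x (- (f x)^-1 ^+ 2 * a).
Proof.
move=> fx0 df; have [dfx <-] := df.
apply: DeriveDef; first exact: derivableV.
by rewrite deriveV // exprVn.
Qed.

Lemma isD_cst (c x : R) : isD (fun=> c) x 0.
Proof. exact: is_derive_cst. Qed.

Lemma isD_id x : isD (fun t => t) x 1.
Proof. exact: is_derive_id. Qed.

Lemma isD_sin x : isD (@sin R) x (cos x). Proof. exact: is_derive_sin. Qed.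
Lemma isD_cos x : isD (@cos R) x (- sin x). Proof. exact: is_derive_cos. Qed.
Lemma isD_expR x : isD (@expR R) x (expR x). Proof. exact: is_derive_expR. Qed.
Lemma isD_ln x : 0 < x -> isD (@ln R) x x^-1. Proof. exact: is_derive1_ln. Qed.
Lemma isD_horner p x : isD (horner p) x p^`().[x]. Proof. exact: is_derive_poly. Qed.

Lemma smooth1_trig I (c d : R) : smooth1 I (fun t => c * cos t + d * sin t).
Proof.
exists [set f | exists c d, f = fun t : R => c * cos t + d * sin t]; first by exists c, d.
move=> _ [{}c [{}d ->]]; exists (fun t => d * cos t + (- c) * sin t);
  first by exists d, (- c).
move=> t _; apply: isD_eq.
  apply: isDD; apply: isDM; [exact: isD_cst|exact: isD_cos|exact: isD_cst|exact: isD_sin].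
by rewrite /=; ring.
Qed.

Lemma smooth1_sin I : smooth1 I (@sin R).
Proof.
have -> : @sin R = (fun t => 0 * cos t + 1 * sin t) by apply/funext => t; ring.
exact: smooth1_trig.
Qed.

Lemma smooth1_cos I : smooth1 I (@cos R).
Proof.
have -> : @cos R = (fun t => 1 * cos t + 0 * sin t) by apply/funext => t; ring.
exact: smooth1_trig.
Qed.

Lemma isD_exprVn c n x : x != 0 ->
  isD (fun t => c * t^-1 ^+ n) x ((- c * n%:R) * x^-1 ^+ n.+1).
Proof.
move=> x0; apply: isD_eq.
  apply: isDM; first exact: isD_cst.
  by apply: isDX; apply: isDV; [|exact: isD_id].
rewrite mul0r add0r; case: n => [|n]; first by ring.
by rewrite /= !exprS; ring.
Qed.

Lemma smooth1_inv : smooth1 [set t : R | t != 0] (fun t => t^-1).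
Proof.
exists [set f | exists c n, f = fun t : R => c * t^-1 ^+ n].
  by exists 1, 1%N; apply/funext => t; rewrite mul1r expr1.
move=> _ [c [n ->]]; exists (fun t => (- c * n%:R) * t^-1 ^+ n.+1).
  by exists (- c * n%:R), n.+1.
by move=> t /= t0; apply: isD_exprVn.
Qed.

Lemma smooth1_ln : smooth1 [set t : R | 0 < t] (@ln R).
Proof.
exists [set f | f = @ln R \/ exists c n, f = fun t : R => c * t^-1 ^+ n]; first by left.
move=> _ [->|[c [n ->]]].
  exists (fun t => 1 * t^-1 ^+ 1); first by right; exists 1, 1%N.
  by move=> t /= t0; apply: is_derive_eq (is_derive1_ln t0) _; rewrite mul1r expr1.
exists (fun t => (- c * n%:R) * t^-1 ^+ n.+1).
  by right; exists (- c * n%:R), n.+1.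
by move=> t /= t0; apply: isD_exprVn; rewrite gt_eqF.
Qed.

End Calculus1.

(** * Flat functions *)

Section Flat.
Context {R : realType}.
Implicit Types (p q r : {poly R}) (t y : R).

Definition decay p q r t : R := expR (- t) * (p.[t] + q.[t] * cos t + r.[t] * sin t).

(** The functions exp(-1/y) (p(1/y) + q(1/y) cos(1/y) + r(1/y) sin(1/y)), extended by
    zero: a family containing the flat function exp(-1/y) and its oscillating
    variants, and stable under differentiation. *)
Definition flat p q r y : R := if 0 < y then decay p q r y^-1 else 0.

Lemma poly_growth p : exists2 C : R, 0 <= C & exists n, forall t, 1 <= t ->
  `|p.[t]| <= C * t ^+ n.
Proof.
elim/poly_ind: p => [|p c [C C0 [n IH]]].
  by exists 0 => //; exists 0%N => t _; rewrite horner0 normr0 mul0r.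
exists (C + `|c|); first by rewrite addr_ge0.
exists n.+1 => t t1; rewrite !hornerE (le_trans (ler_normD _ _)) // mulrDl lerD //.
  rewrite normrM exprSr mulrA (ger0_norm (_ : 0 <= t)) ?ler_pM ?IH //; lra.
by rewrite ler_peMr // exprn_ege1.
Qed.

(** The exponential beats every polynomial; a quadratic rate is what makes the
    extension by zero differentiable at the origin. *)
Lemma decay_bound p q r : exists2 K : R, 0 <= K & forall t, 1 <= t ->
  `|decay p q r t| <= K * t ^- 2.
Proof.
have [Cp Cp0 [np Hp]] := poly_growth p.
have [Cq Cq0 [nq Hq]] := poly_growth q.
have [Cr Cr0 [nr Hr]] := poly_growth r.
pose n := (np + nq + nr)%N.
have G (C : R) (k : nat) t (x : R) : 0 <= C -> 1 <= t -> (k <= n)%N ->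
  `|x| <= C * t ^+ k -> `|x| <= C * t ^+ n.
  by move=> C0 t1 kn /le_trans; apply; rewrite ler_wpM2l // ler_weXn2l.
exists ((Cp + Cq + Cr) * (n.+2)`!%:R); first by rewrite mulr_ge0 // !addr_ge0.
move=> t t1; have t0 : 0 < t by lra.
have qb : `|p.[t] + q.[t] * cos t + r.[t] * sin t| <= (Cp + Cq + Cr) * t ^+ n.
  rewrite !mulrDl (le_trans (ler_normD _ _)) // lerD //.
    rewrite (le_trans (ler_normD _ _)) // lerD //.
      by apply: (@G Cp np) => //; [rewrite /n -addnA leq_addr|apply: Hp].
    rewrite normrM -[leRHS]mulr1 ler_pM //; last by rewrite ler_norml cos_geN1 cos_le1.
    by apply: (@G Cq nq) => //; [rewrite /n -addnA addnCA leq_addr|apply: Hq].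
  rewrite normrM -[leRHS]mulr1 ler_pM //; last by rewrite ler_norml sin_geN1 sin_le1.
  by apply: (@G Cr nr) => //; [rewrite /n leq_addl|apply: Hr].
rewrite /decay normrM (ger0_norm (expR_ge0 _)) expRN.
have e0 := expR_gt0 t.
rewrite mulrC ler_pdivrMr // (le_trans qb) // -!mulrA ler_wpM2l ?addr_ge0 //.
have f0 : 0 < (n.+2)`!%:R :> R by rewrite ltr0n fact_gt0.
have H : t ^+ n.+2 <= (n.+2)`!%:R * expR t.
  rewrite -ler_pdivrMl // mulrC (le_trans _ (expR_ge1Dxn n.+1 (ltW t0))) //.
  by rewrite lerDr.
have -> : (n.+2)`!%:R * (t ^- 2 * expR t) = ((n.+2)`!%:R * expR t) / t ^+ 2 by ring.
by rewrite ler_pdivlMr ?exprn_gt0 // -exprD addn2.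
Qed.

Lemma isD_decay p q r t :
  isD (decay p q r) t (- decay (p - p^`()) (q - q^`() - r) (r - r^`() + q) t).
Proof.
apply: isD_eq.
  apply: isDM; first by apply: (@isD_comp _ expR (fun t => - t));
    [exact: isD_expR|apply: isDN; exact: isD_id].
  apply: isDD; first (apply: isDD; first exact: isD_horner).
    by apply: isDM; [exact: isD_horner|exact: isD_cos].
  by apply: isDM; [exact: isD_horner|exact: isD_sin].
by rewrite /decay /= !(hornerD, hornerN); ring.
Qed.

Lemma isD_quadratic (f : R -> R) (K : R) :
  (forall y, `|y| <= 1 -> `|f y| <= K * y ^+ 2) -> isD f 0 0.
Proof.
move=> fK.
have f0 : f 0 = 0.
  by apply/eqP; rewrite -normr_le0 (le_trans (fK _ _)) ?normr0 // expr0n mulr0.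
have K0 : 0 <= K.
  by have := fK 1; rewrite normr1 => /(_ (lexx _)); rewrite expr1n mulr1; apply: le_trans.
have H : (fun h : R => h^-1 *: (f (h *: (1 : R) + 0) - f 0)) @ 0^' --> (0 : R).
  apply/cvgrPdist_le => e e0.
  near=> h.
  have hn0 : h != 0 by near: h; exact: nbhs_dnbhs_neq.
  rewrite sub0r normrN addr0 f0 subr0 normrM normfV scaler1.
  have h1 : `|h| <= 1.
    near: h; apply/dnbhs0_le; exact: ltr01.
  have nh : 0 < `|h| by rewrite normr_gt0.
  rewrite mulrC ler_pdivrMr // (le_trans (fK h h1)) // -real_normK ?num_real //.
  rewrite expr2 mulrA ler_pM2r //.
  have : `|h| <= e / (K + 1).
    by near: h; apply/dnbhs0_le; rewrite divr_gt0 // ltr_wpDl.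
  rewrite ler_pdivlMr ?ltr_wpDl // => /(le_trans _); apply.
  by rewrite mulrC ler_wpM2l ?normr_ge0 // lerDl.
apply: DeriveDef; first by apply/cvg_ex; exists 0.
exact: cvg_lim H.
Unshelve. all: by end_near.
Qed.

Lemma near_gt (a y : R) : a < y -> \forall z \near y, a < z.
Proof. by move=> ay; apply: open_nbhs_nbhs; split => //; apply: open_gt. Qed.

(** With t = 1/y one has d/dy = - t^2 d/dt; at the origin both the function and its
    difference quotient are dominated by a multiple of the variable. *)
Lemma isD_flat p q r y :
  isD (flat p q r) y (flat ('X^2 * (p - p^`())) ('X^2 * (q - q^`() - r)) ('X^2 * (r -
    r^`() + q)) y).
Proof.
have [y0|y0|<-] := ltgtP 0 y.
- rewrite {2}/flat y0; apply: (@near_eq_is_derive _ _ _ (fun y => decay p q r y^-1)).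
    near=> z; rewrite /flat ifT //; near: z; exact: near_gt.
  have yn : y != 0 by rewrite gt_eqF.
  apply: isD_eq.
    apply: (@isD_comp _ (decay p q r) (fun t => t^-1)); first exact: isD_decay.
    by apply: isDV; [|exact: isD_id].
  by rewrite /decay /= !(hornerM, hornerX, hornerD, hornerN); ring.
- rewrite {2}/flat ltNge ltW //=; apply: (@near_eq_is_derive _ _ _ (fun=> 0)).
  near=> z; rewrite /flat ifF //; apply/negbTE; rewrite -leNgt ltW //; near: z;
    exact: lt_nbhsl.
- rewrite {2}/flat ltxx; have [K K0 HK] := decay_bound p q r.
  apply: (@isD_quadratic _ K) => z z1; rewrite /flat.
  case: ifP => [z0|_]; last by rewrite normr0 mulr_ge0 // sqr_ge0.
  rewrite (le_trans (HK _ _)) ?exprVn ?invrK // invf_ge1 //.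
  by rewrite -(ger0_norm (ltW z0)).
Unshelve. all: by end_near.
Qed.

Lemma smooth1_flat I p q r : smooth1 I (flat p q r).
Proof.
exists [set f | exists p q r, f = flat p q r]; first by exists p, q, r.
move=> _ [{}p [{}q [{}r ->]]]; eexists; last by move=> t _; apply: isD_flat.
by do 3 eexists.
Qed.
End Flat.

(** * The torus as the quotient of a vector space by its integer lattice *)

Section Wrap.
Context {R : realType}.
Implicit Types (a s t : R).

(** The representative of [t] modulo the integers in the unit interval centred at
    [a]. *)
Definition wrap a t : R := t - (Num.floor (t - a + 2^-1))%:~R.

Lemma wrap_bounds a t : a - 2^-1 <= wrap a t < a + 2^-1.
Proof.
have /andP[] := floor_itv (t - a + 2^-1); rewrite /wrap intrD.
by set n := (_%:~R) => h1 h2; apply/andP; split; lra.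
Qed.

Lemma wrap_int a t : wrap a t - t \is a Num.int.
Proof. by rewrite /wrap addrC addKr rpredN intr_int. Qed.

Lemma wrap_id a t : a - 2^-1 <= t < a + 2^-1 -> wrap a t = t.
Proof.
move=> /andP[t1 t2]; rewrite /wrap (@floor_def _ _ 0) ?subr0 //.
by apply/andP; split; rewrite /= ?add0r; lra.
Qed.

Lemma wrap_congr a s t : s - t \is a Num.int -> wrap a s = wrap a t.
Proof.
move=> st; rewrite /wrap.
have -> : s - a + 2^-1 = (t - a + 2^-1) + (s - t) by ring.
by rewrite floorDrz // intrD (floorK st); ring.
Qed.

(** Away from the cut, choosing representatives is locally a translation. All
    chart expressions of maps of tori are affine because of this. *)
Lemma near_wrap a t : a - 2^-1 < wrap a t ->
  \forall s \near t, wrap a s = s + (wrap a t - t).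
Proof.
move=> w1; have /andP[_ w2] := wrap_bounds a t.
have : \forall s \near t, s \in `](t - (wrap a t - (a - 2^-1))),
  (t + (a + 2^-1 - wrap a t))[.
  by apply: near_in_itvoo; rewrite in_itv /=; apply/andP; split; lra.
apply: filterS => s; rewrite in_itv /= => /andP[s1 s2].
rewrite -[RHS](@wrap_id a); last by apply/andP; split; lra.
apply: wrap_congr; rewrite opprD addrA subrr add0r rpredN; exact: wrap_int.
Qed.
End Wrap.

Lemma continuous_addr {R : realType} (V : normedModType R) (k : V) :
  continuous (fun x => x + k).
Proof. by move=> x; apply: cvgD; [exact: cvg_id|exact: cvg_cst]. Qed.

Local Open Scope quotient_scope.

Section Torus.
Context {R : realType} (m : nat).
Implicit Types (x y a : 'rV[R]_m).

Definition lattice_eq x y := [forall i, (x 0 i - y 0 i) \is a Num.int].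

Lemma lattice_eqP x y : reflect (forall i, (x 0 i - y 0 i) \is a Num.int) (lattice_eq x y).
Proof. exact: forallP. Qed.

Lemma lattice_eq_refl : reflexive lattice_eq.
Proof. by move=> x; apply/lattice_eqP => i; rewrite subrr rpred0. Qed.

Lemma lattice_eq_sym : symmetric lattice_eq.
Proof.
move=> x y; apply/lattice_eqP/lattice_eqP => H i; rewrite -opprB rpredN; exact: H.
Qed.

Lemma lattice_eq_trans : transitive lattice_eq.
Proof.
move=> y x z /lattice_eqP xy /lattice_eqP yz; apply/lattice_eqP => i.
by rewrite -(subrKA (y 0 i)) rpredD.
Qed.

Canonical lattice_equiv := EquivRel lattice_eq lattice_eq_refl lattice_eq_sym
  lattice_eq_trans.

Definition torus := quotient_topology {eq_quot lattice_equiv}.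
HB.instance Definition _ := PointedTopological.on torus.

Definition proj x : torus := \pi_{eq_quot lattice_equiv} x.
Definition lift (p : torus) : 'rV[R]_m := repr (p : {eq_quot lattice_equiv}).

Lemma liftK p : proj (lift p) = p.
Proof. exact: reprK. Qed.

Lemma projP x y : proj x = proj y <-> lattice_eq x y.
Proof. by split => [/eqmodP|H]; last exact/eqmodP. Qed.

Lemma lift_proj x : lattice_eq (lift (proj x)) x.
Proof. by apply/projP; rewrite liftK. Qed.

Lemma proj_continuous : continuous proj.
Proof. exact: pi_continuous. Qed.

(** The saturation of an open set is the union of its integer translates. *)
Lemma open_proj (U : set 'rV[R]_m) : open U -> open (proj @` U).
Proof.
move=> oU; rewrite /open /= /quotient_open.
have -> : \pi_{eq_quot lattice_equiv} @^-1` (proj @` U) =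
  \bigcup_(k in [set k : 'rV[R]_m | forall i, k 0 i \is a Num.int]) ((fun x =>
    x + k) @^-1` U).
  apply/seteqP; split=> x /=.
    move=> [y Uy /projP/lattice_eqP yx]; exists (y - x); first by move=> i; rewrite !mxE.
    by rewrite /= addrC subrK.
  move=> [k ki /= Uxk]; exists (x + k) => //; apply/projP/lattice_eqP => i.
  by rewrite mxE addrAC subrr add0r.
apply: bigcup_open => k _.
have ck : continuous (fun x : 'rV[R]_m => x + k).
  exact: continuous_addr.
by move/continuousP : ck; apply.
Qed.

Lemma near_coord (P : R -> Prop) x i :
  (\forall t \near x 0 i, P t) -> \forall y \near x, P ((y : 'rV[R]_m) 0 i).
Proof.
move=> H.
have C : (fun y : 'rV[R]_m => y 0 i) y @[y --> x] --> x 0 i by apply: coord_continuous.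
exact: C _ H.
Qed.

Lemma near_coords (P : 'I_m -> R -> Prop) x :
  (forall i, \forall t \near x 0 i, P i t) ->
    \forall y \near x, forall i, P i ((y : 'rV[R]_m) 0 i).
Proof.
move=> H; apply: (@filter_forall _ _ (fun i (y : 'rV[R]_m) => P i (y 0 i)) (nbhs x)) => i.
exact: near_coord.
Qed.

Definition cube a : set 'rV[R]_m := [set x | forall i, a 0 i - 2^-1 < x 0 i < a 0 i + 2^-1].

Lemma open_cube a : open (cube a).
Proof.
rewrite openE => x ax; rewrite /interior.
apply: (@near_coords (fun i t => a 0 i - 2^-1 < t < a 0 i + 2^-1)) => i.
have := @near_in_itvoo R (a 0 i - 2^-1) (a 0 i + 2^-1) (x 0 i).
by rewrite in_itv /= => /(_ (ax i)); apply: filterS => t; rewrite in_itv.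
Qed.

Definition rep a x : 'rV[R]_m := \row_i wrap (a 0 i) (x 0 i).

Lemma rep_lattice a x : lattice_eq (rep a x) x.
Proof. by apply/lattice_eqP => i; rewrite mxE wrap_int. Qed.

Lemma proj_rep a x : proj (rep a x) = proj x.
Proof. exact/projP/rep_lattice. Qed.

Lemma rep_congr a x y : proj x = proj y -> rep a x = rep a y.
Proof. by move/projP/lattice_eqP => xy; apply/rowP => i; rewrite !mxE;
  apply: wrap_congr. Qed.

Lemma rep_id a x : cube a x -> rep a x = x.
Proof.
move=> ax; apply/rowP => i; rewrite mxE wrap_id //.
by have /andP[/ltW -> ->] := ax i.
Qed.

(** The chart around the class of [a] is the inverse of the projection on the open
    unit cube centred at [a]. *)
Definition tchart a : chart R torus m :=
  Chart (proj @` cube a) (fun p => rep a (lift p)) proj.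

Definition tatlas : set (chart R torus m) := range tchart.

Lemma rep_lift a x : rep a (lift (proj x)) = rep a x.
Proof. by apply: rep_congr; rewrite liftK. Qed.

Lemma tmap_proj a x : cmap (tchart a) (proj x) = rep a x.
Proof. exact: rep_lift. Qed.

Lemma tdom_proj a x : cdom (tchart a) (proj x) <-> cube a (rep a x).
Proof.
split=> [[y ay yx]|H]; first by rewrite (rep_congr a (esym yx)) rep_id.
by exists (rep a x) => //; apply: proj_rep.
Qed.

Lemma tcmapK a p : cdom (tchart a) p -> cinv (tchart a) (cmap (tchart a) p) = p.
Proof. by move=> _; rewrite /= proj_rep liftK. Qed.

Lemma tcimg a : cimg (tchart a) = cube a.
Proof.
apply/seteqP; split=> x.
  by move=> [_ [y ay <-] <-]; rewrite tmap_proj rep_id.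
by move=> ax; exists (proj x); [exists x|rewrite tmap_proj rep_id].
Qed.

Lemma near_rep a x : cdom (tchart a) (proj x) ->
  \forall y \near x, rep a y = y + (rep a x - x).
Proof.
move=> /tdom_proj ax.
have : \forall y \near x, forall i,
  wrap (a 0 i) ((y : 'rV[R]_m) 0 i) = y 0 i + (wrap (a 0 i) (x 0 i) - x 0 i).
  apply: (@near_coords (fun i t => wrap (a 0 i) t = t + (wrap (a 0 i) (x 0 i) - x 0 i))).
  by move=> i; apply: near_wrap; have := ax i; rewrite mxE => /andP[].
by apply: filterS => y H; apply/rowP => i; rewrite !mxE.
Qed.

Lemma tchart_is_chart a : is_chart (tchart a).
Proof.
have od : open (cdom (tchart a)) by apply/open_proj/open_cube.
split=> //.
- by rewrite tcimg; apply: open_cube.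
- apply/continuous_in_subspaceT => p; rewrite inE => -[x ax <-].
  move=> V; rewrite tmap_proj rep_id // => Vx.
  have [W [oW Wx] WV] : exists2 W, open_nbhs x W & W `<=` V by move: Vx; rewrite nbhsE.
  have oI : open (W `&` cube a) by apply: openI => //; apply: open_cube.
  rewrite nbhs_simpl /=; apply: (@filterS _ _ _ (proj @` (W `&` cube a))).
    by move=> _ [y [Wy ay] <-] /=; rewrite rep_lift rep_id //; apply: WV.
  by apply: open_nbhs_nbhs; split; [apply: open_proj|exists x].
- by apply: continuous_subspaceT; apply: proj_continuous.
- exact: tcmapK.
Qed.

Lemma tatlas_chart c : tatlas c -> is_chart c.
Proof. by move=> [a _ <-]; apply: tchart_is_chart. Qed.

Lemma tatlas_cover p : exists2 c, tatlas c & cdom c p.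
Proof.
exists (tchart (lift p)); first by exists (lift p).
by exists (lift p); [move=> i; apply/andP; split; lra|apply: liftK].
Qed.

(** Two points that differ modulo the lattice differ so in some coordinate; if the
    difference of these coordinates has fractional part u in ]0, 1[, bands of width
    min(u, 1 - u) around the two points have disjoint projections. *)
Lemma torus_hausdorff : hausdorff_space torus.
Proof.
rewrite open_hausdorff => p q; rewrite -(liftK p) -(liftK q).
move: (lift p) (lift q) => x y /eqP xy.
have /existsP[i xyi] : [exists i, (x 0 i - y 0 i) \isn't a Num.int].
  by apply: contra_notT xy; rewrite negb_exists => /forallP H; apply/projP/lattice_eqP => i;
    have := H i; rewrite negbK.
have /andP[f1 f2] := floor_itv (x 0 i - y 0 i).
rewrite intrEfloor in xyi; rewrite intrD in f2.
have {f1}f1 : (Num.floor (x 0 i - y 0 i))%:~R < x 0 i - y 0 i by rewrite lt_neqAle xyi.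
set n := Num.floor _ in f1 f2.
pose u := x 0 i - y 0 i - n%:~R; pose d := Num.min u (1 - u) / 2.
have u01 : 0 < u < 1 by rewrite /u; apply/andP; split; lra.
have d0 : 0 < d by rewrite divr_gt0 // lt_min; apply/andP; split; lra.
have d1 : d * 2 <= u by rewrite divfK // ge_min lexx.
have d2 : d * 2 <= 1 - u by rewrite divfK // ge_min lexx orbT.
have op (z : 'rV[R]_m) : open (proj @` [set w : 'rV[R]_m | z 0 i - d < w 0 i < z 0 i + d]).
  apply: open_proj; rewrite openE => w /= zw; rewrite /interior.
  have := @near_in_itvoo R (z 0 i - d) (z 0 i + d) (w 0 i).
  rewrite in_itv /= => /(_ zw) H.
  by move: H => /near_coord; apply: filterS => v /=; rewrite in_itv.
exists (proj @` [set w : 'rV[R]_m | x 0 i - d < w 0 i < x 0 i + d],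
        proj @` [set w : 'rV[R]_m | y 0 i - d < w 0 i < y 0 i + d]) => /=.
  by split; rewrite inE; [exists x|exists y] => //=; apply/andP; split; lra.
split=> //; apply/eqP/seteqP;
  split=> // _ [[v /= /andP[v1 v2] <-] [w /= /andP[w1 w2] /projP/lattice_eqP/(_ i)]].
move=> /intrP[k wk].
have wkN : (- k)%:~R = - (w 0 i - v 0 i) :> R by rewrite mulrNz wk.
have kn : (- k) = n.
  apply/eqP; rewrite eq_sym -subr_eq0.
  have k1 : (n - - k)%:~R < 1%:~R :> R by rewrite intrB wkN; rewrite /u in u01 d1 d2; lra.
  have k2 : (-1)%:~R < (n - - k)%:~R :> R by rewrite intrB wkN; rewrite /u in u01 d1 d2;
    lra.
  rewrite !ltr_int in k1 k2.
  by rewrite eq_le; apply/andP; split; [rewrite -ltzD1 add0r|rewrite -ltzD1 -ltrBlDr sub0r].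
have : n%:~R = - (w 0 i - v 0 i) :> R by rewrite -kn.
by rewrite /u in u01 d1 d2; lra.
Qed.

Lemma torus_compact : compact [set: torus].
Proof.
have -> : [set: torus] = proj @` [set x : 'rV[R]_m | forall i, `[0, 1]%classic (x 0 i)].
  apply/seteqP; split=> // p _; exists (rep (const_mx 2^-1) (lift p));
    last by rewrite proj_rep liftK.
  move=> i /=; rewrite !mxE in_itv /=.
  have /andP[] := wrap_bounds 2^-1 (lift p 0 i); rewrite subrr => -> /ltW h /=.
  by apply: le_trans h _; lra.
apply: continuous_compact; first by apply: continuous_subspaceT; apply: proj_continuous.
by apply: (@rV_compact R m (fun=> `[0, 1]%classic)) => i; apply: segment_compact.
Qed.

(** The torus is a union of projected segments issued from the origin. *)
Lemma torus_connected : connected [set: torus].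
Proof.
have -> : [set: torus] = \bigcup_(x in [set: 'rV[R]_m]) ((fun t : R =>
  proj (t *: x)) @` `[0, 1]%classic).
  apply/seteqP; split=> // p _; exists (lift p) => //; exists 1;
    last by rewrite scale1r liftK.
  by rewrite /= in_itv /= lexx ler01.
apply: bigcup_connected.
  by exists (proj 0) => x _; exists 0; rewrite ?scale0r //= in_itv /= lexx ler01.
move=> x _; apply: connected_continuous_connected; first exact: segment_connected.
apply: continuous_subspaceT => t; apply: continuous_comp; last exact: proj_continuous.
exact: scalel_continuous.
Qed.
End Torus.

(** * Jacobians, and lattice-invariant tensors on the torus *)

Section Jacobian.
Context {R : realType}.

Lemma eq_mulmx_row p q (A B : 'M[R]_(p, q)) :
  (forall v : 'rV[R]_p, v *m A = v *m B) -> A = B.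
Proof. by move=> AB; apply/row_matrixP => i; rewrite !rowE. Qed.

(** The jacobian is determined by the directional derivatives, which are local. *)
Lemma near_jacobian p q (f g : 'rV[R]_p -> 'rV[R]_q) (x : 'rV[R]_p) :
  {near x, f =1 g} -> differentiable f x -> 'J f x = 'J g x.
Proof.
move=> fg df; have dg := near_differentiable fg df.
apply: eq_mulmx_row => v; apply: etrans (esym (deriveEjacobian v df)) _.
apply: etrans _ (deriveEjacobian v dg); exact: near_eq_derive.
Qed.

Lemma jacobian_comp p q r (f : 'rV[R]_p -> 'rV[R]_q) (g : 'rV[R]_q -> 'rV[R]_r) x :
  differentiable f x -> differentiable g (f x) ->
  'J (g \o f) x = 'J f x *m 'J g (f x).
Proof.
move=> df dg; have dgf := differentiable_comp df dg.
apply: eq_mulmx_row => v; apply: etrans (esym (deriveEjacobian v dgf)) _.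
rewrite (deriveE v dgf) (diff_comp df dg) /= -(deriveE v df) -(deriveE _ dg).
by rewrite (deriveEjacobian v df) (deriveEjacobian _ dg) mulmxA.
Qed.

Lemma smooth_on_affine p q (U : set 'rV[R]_p) (E : 'M[R]_(p, q)) (k : 'rV[R]_q) :
  open U -> smooth_on U (fun x => x *m E + k).
Proof.
move=> oU; apply: smooth_onD => //; last exact: smooth_on_cst.
apply: smooth_on_mx => // i j.
under eq_fun do rewrite mxE.
elim: (index_enum _) => [|l r IH].
  by under eq_fun do rewrite big_nil; apply: (@smooth_on_cst _ _ _ _ (0 : R)).
under eq_fun do rewrite big_cons; apply: smooth_onD => //.
apply: smooth_onM => //; last exact: (@smooth_on_cst _ _ _ _ (E l j)).
by rewrite ord1; apply: smooth_on_coord.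
Qed.

Lemma differentiable_affine p q (E : 'M[R]_(p, q)) (k : 'rV[R]_q) x :
  differentiable (fun x => x *m E + k) x.
Proof. exact: (@smooth_on_affine p q setT E k openT [::]). Qed.

Lemma is_derive_affine p q (E : 'M[R]_(p, q)) (k : 'rV[R]_q) (x v : 'rV[R]_p) :
  'D_v (fun x => x *m E + k) x = v *m E.
Proof.
rewrite /derive; apply: cvg_lim => //.
apply: (@cvg_trans _ (cst (v *m E) h @[h --> 0^'])); last exact: cvg_cst.
apply: near_eq_cvg; near=> h.
have h0 : h != 0 by near: h; exact: nbhs_dnbhs_neq.
rewrite /= mulmxDl -scalemxAl -(addrA (h *: (v *m E))) addrK scalerA mulVf //.
by rewrite scale1r.
Unshelve. all: by end_near. Qed.

Lemma jacobian_affine p q (E : 'M[R]_(p, q)) (k : 'rV[R]_q) x :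
  'J (fun x => x *m E + k) x = E.
Proof.
apply: eq_mulmx_row => v.
by apply: etrans (esym (deriveEjacobian v (differentiable_affine E k x))) _;
  apply: is_derive_affine.
Qed.
End Jacobian.

Section ChartChain.
Context {R : realType}.

Lemma is_chartK (M : topologicalType) n (c : chart R M n) x : is_chart c -> cimg c x ->
  cmap c (cinv c x) = x /\ cdom c (cinv c x).
Proof. by move=> [_ _ _ _ cK] [p cp <-]; rewrite cK. Qed.

Lemma near_cinv (M : topologicalType) n (c : chart R M n) (W : set M) p :
  is_chart c -> open W -> cdom c p -> W p ->
  \forall y \near cmap c p, cimg c y /\ W (cinv c y).
Proof.
move=> [_ oI _ ci cK] oW cp Wp; have Ip : cimg c (cmap c p) by exists p.
apply: filterI; first exact: open_nbhs_nbhs.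
move: ci; rewrite continuous_open_subspace // => /(_ (cmap c p)); rewrite inE => /(_ Ip).
by apply; apply: open_nbhs_nbhs; split => //; rewrite cK.
Qed.

Lemma near_in_charts (M N : topologicalType) m n (c c0 : chart R M m) (d : chart R N n) f
  p :
  is_chart c -> is_chart c0 -> cdom c p -> cdom c0 p ->
  {near cmap c p, in_charts c0 d f \o in_charts c c0 id =1 in_charts c d f}.
Proof.
move=> ic ic0 cp c0p; have [oc0 _ _ _ c0K] := ic0.
have := near_cinv ic oc0 cp c0p; apply: filterS => y [_ c0y] /=.
by rewrite /in_charts /= c0K.
Qed.

(** Near [p] the expression of [f] in the charts [c], [d] factors through the change of
    charts from [c] to [c0]. *)
Lemma jac_chain (M N : topologicalType) m n (c c0 : chart R M m) (d : chart R N n) f p :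
  is_chart c -> is_chart c0 -> cdom c p -> cdom c0 p ->
  differentiable (in_charts c c0 id) (cmap c p) ->
  differentiable (in_charts c0 d f) (cmap c0 p) ->
  jac c d f p = jac c c0 id p *m jac c0 d f p.
Proof.
move=> ic ic0 cp c0p d1 d2.
have e : in_charts c c0 id (cmap c p) = cmap c0 p.
  by have [_ _ _ _ cK] := ic; rewrite /in_charts /= cK.
rewrite -e in d2; have d3 := differentiable_comp d1 d2.
have J := jacobian_comp d1 d2; rewrite e in J.
exact: etrans (esym (near_jacobian (near_in_charts d f ic ic0 cp c0p) d3)) J.
Qed.

Lemma jac_id (M : topologicalType) m (c : chart R M m) p :
  is_chart c -> cdom c p -> jac c c id p = 1%:M.
Proof.
move=> ic cp; rewrite -[RHS](@jacobian_affine R m m 1%:M 0 (cmap c p)).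
apply/esym/near_jacobian; last exact: differentiable_affine.
have [oc _ _ _ _] := ic.
have := near_cinv ic oc cp cp; apply: filterS => y [Iy _].
by rewrite mulmx1 addr0 /in_charts /=; have [-> _] := is_chartK ic Iy.
Qed.

Lemma compatible_diff (M : topologicalType) m (c d : chart R M m) p : compatible c d ->
  cdom c p -> cdom d p -> differentiable (in_charts c d id) (cmap c p).
Proof. by move=> cd cp dp; apply: (cd [::]); exists p. Qed.
End ChartChain.

Section TorusCharts.
Context {R : realType}.

(** The representative used by the target chart is locally a fixed translate of
    [phi], so that the chart expression inherits the form of the lift. *)
Lemma near_lift m n (f : torus m -> torus n) (phi : 'rV[R]_m -> 'rV[R]_n) a b p :
  (forall x, f (proj x) = proj (phi x)) -> continuous phi ->
  cdom (tchart a) p -> cdom (tchart b) (f p) ->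
  {near cmap (tchart a) p, in_charts (tchart a) (tchart b) f =1
     fun x => phi x + (cmap (tchart b) (f p) - phi (cmap (tchart a) p))}.
Proof.
move=> fphi cphi ap bfp; set x := cmap (tchart a) p.
have px : p = proj x by rewrite /x /= proj_rep liftK.
rewrite px fphi in bfp *.
have := near_rep bfp; rewrite -(rep_lift b) => H.
have H2 : \forall y \near x, rep b (phi y) = phi y + (rep b (lift (proj (phi x))) - phi x).
  exact: (cphi x) _ H.
apply: filterS H2 => y Hy.
by rewrite /in_charts /= fphi rep_lift Hy.
Qed.

Lemma torus_compatible m (c d : chart R (torus m) m) : tatlas c -> tatlas d ->
  compatible c d.
Proof.
move=> [a _ <-] [b _ <-]; apply: near_smooth_on => _ [p [ap bp] <-].
exists setT, (fun x => x *m 1%:M + (cmap (tchart b) p - cmap (tchart a) p)); split=> //.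
  exact: (@smooth_on_affine R m m setT 1%:M _ openT).
have cid : continuous (id : 'rV[R]_m -> 'rV[R]_m) by move=> x; apply: cvg_id.
have := @near_lift m m id id a b p (fun=> erefl) cid ap bp.
by apply: filterS => y ->; rewrite mulmx1.
Qed.

Lemma tchart_jac m n (f : torus m -> torus n) (E : 'M[R]_(m, n)) (k : 'rV[R]_n) a b p :
  (forall x, f (proj x) = proj (x *m E + k)) ->
  cdom (tchart a) p -> cdom (tchart b) (f p) ->
  differentiable (in_charts (tchart a) (tchart b) f) (cmap (tchart a) p) /\
  jac (tchart a) (tchart b) f p = E.
Proof.
move=> fE ap bfp.
have cphi : continuous (fun x : 'rV[R]_m => x *m E + k).
  by move=> x; apply: differentiable_continuous (differentiable_affine E k x).
have := near_lift fE cphi ap bfp.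
set l := cmap _ (f p) - _ => H.
have {}H : {near cmap (tchart a) p, (fun x =>
  x *m E + (k + l)) =1 in_charts (tchart a) (tchart b) f}.
  by apply: filterS H => y ->; rewrite addrA.
have dl := @differentiable_affine R m n E (k + l) (cmap (tchart a) p).
split; first exact: near_differentiable H dl.
by rewrite /jac -(near_jacobian H) // jacobian_affine.
Qed.

(** Transition maps are translations by integer vectors. *)
Lemma tchart_jac_id m a b (p : torus m) : cdom (tchart a) p -> cdom (tchart b) p ->
  jac (tchart a) (tchart b) id p = 1%:M :> 'M[R]_m.
Proof.
move=> ap bp; have := @tchart_jac m m id 1%:M 0 a b p _ ap bp.
by case=> // x; rewrite mulmx1 addr0.
Qed.

Lemma torus_oriented m : oriented_atlas (@tatlas R m).
Proof.
split; last first.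
  by move=> _ _ [a _ <-] [b _ <-] p ap bp; rewrite tchart_jac_id // det1 ltr01.
split; [exact: tatlas_chart|exact: tatlas_cover|exact: torus_compatible].
Qed.

Lemma torus_closed m : closed_manifold (@tatlas R m).
Proof.
by split; [apply: torus_hausdorff|apply: torus_compact|have [] := torus_oriented m].
Qed.

Lemma tlift_dom m (p : torus m) : cdom (@tchart R m (lift p)) p.
Proof. by exists (lift p); [move=> i; apply/andP; split; lra|apply: liftK]. Qed.

Lemma smooth_chart_diff m (c : chart R (torus m) m) p a :
  smooth_chart (@tatlas R m) c -> cdom c p -> cdom (tchart a) p ->
  differentiable (in_charts c (tchart a) id) (cmap c p) /\
  differentiable (in_charts (tchart a) c id) (cmap (tchart a) p).
Proof.
move=> [ic sc] cp ap; have At : tatlas (@tchart R m a) by exists a.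
by split; apply: compatible_diff => //; have [] := sc _ At.
Qed.

Lemma smooth_jac_chain m (N : topologicalType) n (c : chart R (torus m) m) (d : chart R N
  n) f p a :
  smooth_chart (@tatlas R m) c -> cdom c p -> cdom (tchart a) p ->
  differentiable (in_charts (tchart a) d f) (cmap (tchart a) p) ->
  jac c d f p = jac c (tchart a) id p *m jac (tchart a) d f p.
Proof.
move=> sc cp ap df; have [d1 _] := smooth_chart_diff sc cp ap; have [ic _] := sc.
by apply: jac_chain => //; apply: tchart_is_chart.
Qed.

(** A chart of the maximal atlas is compared with the torus charts by the chain rule;
    all computations in arbitrary charts reduce to [E] in this way. *)
Lemma smooth_jac_lift m n (c : chart R (torus m) m) (f : torus m -> torus n)
    (E : 'M[R]_(m, n)) (k : 'rV[R]_n) p a b :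
  (forall x, f (proj x) = proj (x *m E + k)) ->
  smooth_chart (@tatlas R m) c -> cdom c p -> cdom (tchart a) p -> cdom (tchart b) (f p) ->
  jac c (tchart b) f p = jac c (tchart a) id p *m E.
Proof.
move=> fE sc cp ap bfp; have [df <-] := tchart_jac fE ap bfp.
exact: smooth_jac_chain.
Qed.

Lemma smooth_jac_id m (c : chart R (torus m) m) p a b :
  smooth_chart (@tatlas R m) c -> cdom c p -> cdom (tchart a) p -> cdom (tchart b) p ->
  jac c (tchart b) id p = jac c (tchart a) id p.
Proof.
move=> sc cp ap bp; rewrite -[RHS]mulmx1.
by apply: (@smooth_jac_lift _ _ _ _ _ 0) => // x; rewrite mulmx1 addr0.
Qed.

Lemma smooth_jacV m (c : chart R (torus m) m) p a :
  smooth_chart (@tatlas R m) c -> cdom c p -> cdom (tchart a) p ->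
  jac (tchart a) c id p *m jac c (tchart a) id p = 1%:M.
Proof.
move=> sc cp ap; have [d1 d2] := smooth_chart_diff sc cp ap; have [ic _] := sc.
have ia := tchart_is_chart a.
by rewrite -(jac_chain ia ic ap cp d2 d1) jac_id.
Qed.

Lemma smooth_jacV' m (c : chart R (torus m) m) p a :
  smooth_chart (@tatlas R m) c -> cdom c p -> cdom (tchart a) p ->
  jac c (tchart a) id p *m jac (tchart a) c id p = 1%:M.
Proof.
move=> sc cp ap; have [d1 d2] := smooth_chart_diff sc cp ap; have [ic _] := sc.
have ia := tchart_is_chart a.
by rewrite -(jac_chain ic ia cp ap d1 d2) jac_id.
Qed.

(** As transition maps of the atlas have jacobian one, a matrix valued function on the
    torus is a tensor field, extended to the other charts by the transformation
    law. The case distinction makes chart expressions in the atlas equal to [G]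
    also outside the domain of the chart, so that no localisation is needed when
    they are differentiated. *)
Definition invariant_tensor m (G : torus m -> 'M[R]_m) : @tensor R (torus m) m := fun c p =>
  if pselect (tatlas c) then G p else
  let J := jac c (tchart (lift p)) id p in J *m G p *m J^T.

Lemma invariant_tensorE m (G : torus m -> 'M[R]_m) c p a :
  smooth_chart (@tatlas R m) c -> cdom c p -> cdom (tchart a) p ->
  invariant_tensor G c p = jac c (tchart a) id p *m G p *m (jac c (tchart a) id p)^T.
Proof.
move=> [ic sc] cp ap; rewrite /invariant_tensor; case: (pselect (tatlas c)) => [Ac|nAc] /=.
  suff -> : jac c (tchart a) id p = 1%:M by rewrite mul1mx trmx1 mulmx1.
  by move: cp => {ic sc}; have [b _ <-] := Ac => cp; rewrite tchart_jac_id.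
suff -> : jac c (tchart (lift p)) id p = jac c (tchart a) id p by [].
exact: (smooth_jac_id (conj ic sc) cp ap (tlift_dom p)).
Qed.

Lemma invariant_tensor_atlas m (G : torus m -> 'M[R]_m) c p : tatlas c ->
  invariant_tensor G c p = G p.
Proof. by rewrite /invariant_tensor; case: pselect. Qed.

(** Both sides are transported from the same torus chart, and the jacobians from
    [c] and from [d] to that chart differ by the jacobian from [c] to [d]. *)
Lemma invariant_tensor_pullback m (G : torus m -> 'M[R]_m) :
  @is_pullback R (torus m) (torus m) m m (@tatlas R m) (@tatlas R m) id (invariant_tensor
    G) (invariant_tensor G).
Proof.
move=> c d p sc sd cp dp0; have dp : cdom d p by []; have lp := tlift_dom p.
rewrite (invariant_tensorE G sc cp lp) (invariant_tensorE G sd dp lp).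
set K := jac c d id p; set Jc := jac c _ id p; set Jd := jac d _ id p.
suff -> : Jc = K *m Jd by rewrite trmx_mul !mulmxA.
have V := smooth_jacV sd dp lp.
have C := smooth_jac_chain sc cp lp (smooth_chart_diff sd dp lp).2.
apply: (etrans (esym (mulmx1 Jc))); apply: (etrans (esym (congr1 (mulmx Jc) V))).
exact: (etrans (mulmxA _ _ _) (esym (congr1 (fun X => X *m Jd) C))).
Qed.

Lemma pos_def_congr m (J K G : 'M[R]_m) : J *m K = 1%:M -> pos_def G ->
  pos_def (J *m G *m J^T).
Proof.
move=> JK [GT Gp]; split; first by rewrite !trmx_mul trmxK GT mulmxA.
move=> v v0; have := Gp (v *m J); rewrite trmx_mul !mulmxA; apply.
by apply: contra v0 => /eqP vJ; rewrite -(mulmx1 v) -JK mulmxA vJ mul0mx.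
Qed.

Lemma invariant_tensor_riemannian m (G : torus m -> 'M[R]_m) :
  (forall p, pos_def (G p)) -> smooth_on setT (fun x => G (proj x)) ->
  @riemannian_metric R (torus m) m (@tatlas R m) (invariant_tensor G).
Proof.
move=> Gp Gs; split; first exact: invariant_tensor_pullback.
  move=> c p sc cp; have lp := tlift_dom p.
  rewrite (invariant_tensorE G sc cp lp); apply: pos_def_congr (Gp p).
  exact: (smooth_jacV' sc cp lp).
move=> c Ac s x _; have -> : @local R (torus m) m (invariant_tensor G) c = (fun x =>
  G (proj x)); last exact: Gs.
by apply/funext => y; rewrite /local invariant_tensor_atlas //; move: Ac => [a _ <-].
Qed.
End TorusCharts.

(** * The square with paired sides and the genus of the torus *)

Section Genus.
Context {R : realType}.
Implicit Types (a b r s : R) (x y : 'rV[R]_2).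

Lemma row2E0 a b : row2 a b 0 0 = a.
Proof. by rewrite mxE. Qed.

Lemma row2E1 a b : row2 a b 0 1 = b.
Proof. by rewrite mxE. Qed.

Lemma row2_eta x : x = row2 (x 0 0) (x 0 1).
Proof.
apply/rowP => i; rewrite mxE; case: eqP => [->//|/eqP i0].
by congr (x 0 _); apply/val_inj; case: i i0 => -[|[|]].
Qed.

Lemma row2D a b a' b' : row2 a b + row2 a' b' = row2 (a + a') (b + b').
Proof. by apply/rowP => i; rewrite !mxE; case: ifP. Qed.

Lemma row2Z r a b : r *: row2 a b = row2 (r * a) (r * b).
Proof. by apply/rowP => i; rewrite !mxE; case: ifP. Qed.

(** The polygon is the square with vertices (1,0), (0,1), (-1,0), (0,-1). In the
    coordinates along its sides it becomes the product of two intervals of length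
    one, and the pairing of opposite sides becomes translation by one. *)
Definition diag a b : 'rV[R]_2 := row2 (a + b) (a - b).

Definition half a := (- 2^-1 <= a <= 2^-1).

Lemma diag_eta x : x = diag ((x 0 0 + x 0 1) / 2) ((x 0 0 - x 0 1) / 2).
Proof. by rewrite {1}(row2_eta x) /diag; congr row2; field. Qed.

Lemma vertexE j : vertex 1 j = row2 (cos (pi / 2 * j%:R)) (sin (pi / 2 * j%:R)) :> 'rV[R]_2.
Proof.
rewrite /vertex; have -> : 2 * pi * j%:R / (4 * 1)%:R = pi / 2 * j%:R :> R; last by [].
by rewrite muln1; field.
Qed.

Lemma vertex0 : vertex 1 0 = row2 1 0 :> 'rV[R]_2.
Proof. by rewrite vertexE mulr0 cos0 sin0. Qed.

Lemma vertex1 : vertex 1 1 = row2 0 1 :> 'rV[R]_2.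
Proof. by rewrite vertexE mulr1 cos_pihalf sin_pihalf. Qed.

Lemma vertex2 : vertex 1 2 = row2 (-1) 0 :> 'rV[R]_2.
Proof. by rewrite vertexE divfK // cospi sinpi. Qed.

Lemma vertex3 : vertex 1 3 = row2 0 (-1) :> 'rV[R]_2.
Proof.
rewrite vertexE; have -> : pi / 2 * 3%:R = pi / 2 + pi :> R by field.
by rewrite cosDpi sinDpi cos_pihalf sin_pihalf oppr0.
Qed.

Lemma vertex4 : vertex 1 4 = row2 1 0 :> 'rV[R]_2.
Proof.
rewrite vertexE; have -> : pi / 2 * 4%:R = pi *+ 2 :> R by rewrite -mulr_natr; field.
by rewrite cos2pi sin2pi.
Qed.

(** In the rotated coordinates the barycentric weights of a point of the square can
    be taken to be products of the affine functions vanishing on its sides. *)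
Lemma polygon_diag x : polygon 1 x <->
  half ((x 0 0 + x 0 1) / 2) && half ((x 0 0 - x 0 1) / 2).
Proof.
split=> [[w [w0 w1 xw]]|/andP[/andP[a1 a2] /andP[b1 b2]]].
  pose W : 'I_4 -> R := w.
  have W0 j : 0 <= W j by apply: w0.
  have W1 : \sum_(j < 4) W j = 1 by apply: w1.
  have xW : x = \sum_(j < 4) W j *: vertex 1 j by apply: xw.
  move: xW W1; rewrite !big_ord_recr !big_ord0 /=.
  rewrite vertex0 vertex1 vertex2 vertex3 !row2Z !add0r !row2D => ->.
  rewrite row2E0 row2E1.
  have := W0 (widen_ord (leqnSn 3) (widen_ord (leqnSn 2) (widen_ord (leqnSn 1) ord_max))).
  have := W0 (widen_ord (leqnSn 3) (widen_ord (leqnSn 2) ord_max)).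
  have := W0 (widen_ord (leqnSn 3) ord_max); have := W0 ord_max.
  move: (W _) (W _) (W _) (W _) => w3 w2 w1' w0' h3 h2 h1 h0 h.
  by apply/andP; split; apply/andP; split; lra.
set a := _ / 2 in a1 a2; set b := _ / 2 in b1 b2.
pose f (j : nat) : R := nth 0 [:: (2^-1 + a) * (2^-1 + b); (2^-1 + a) * (2^-1 - b);
   (2^-1 - a) * (2^-1 - b); (2^-1 - a) * (2^-1 + b)] j.
exists (fun j => f (val j)); rewrite /f; split.
- by case=> -[|[|[|[|j]]]] //= _; apply: mulr_ge0; lra.
- suff: \sum_(j < 4) f (val j) = 1 by [].
  by rewrite /f !big_ord_recr big_ord0 /=; field.
- suff: x = \sum_(j < 4) f (val j) *: vertex 1 (val j) by [].
  rewrite /f !big_ord_recr big_ord0 /=.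
  rewrite vertex0 vertex1 vertex2 vertex3 !row2Z add0r !row2D [LHS]diag_eta -/a -/b.
  by rewrite /diag; congr row2; field.
Qed.

Lemma half_diag a b : ((diag a b) 0 0 + (diag a b) 0 1) / 2 = a /\
  ((diag a b) 0 0 - (diag a b) 0 1) / 2 = b.
Proof. by rewrite /diag row2E0 row2E1; split; field. Qed.

Definition glue x : torus 2 := proj (row2 ((x 0 0 + x 0 1) / 2) ((x 0 0 - x 0 1) / 2)).

Lemma glue_diag a b : glue (diag a b) = proj (row2 a b).
Proof. by rewrite /glue; have [-> ->] := half_diag a b. Qed.

Lemma proj_row2 a b a' b' : proj (row2 a b) = proj (row2 a' b') :> torus 2 <->
  (a - a' \is a Num.int) && (b - b' \is a Num.int).
Proof.
split=> [/projP/lattice_eqP H|/andP[aa bb]].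
  by apply/andP; split; [have := H 0; rewrite !row2E0|have := H 1; rewrite !row2E1].
apply/projP/lattice_eqP => i; rewrite !mxE; by case: ifP.
Qed.

(** Two points of an interval of length one are congruent only if they are equal or
    are its two ends. *)
Lemma half_int a a' : half a -> half a' -> a - a' \is a Num.int ->
  [\/ a = a', a = 2^-1 /\ a' = - 2^-1 | a = - 2^-1 /\ a' = 2^-1].
Proof.
move=> /andP[a1 a2] /andP[b1 b2] /intrP[k ak].
have k1 : k%:~R <= 1%:~R :> R by rewrite -ak; lra.
have k2 : (-1)%:~R <= k%:~R :> R by rewrite -ak mulrNz; lra.
rewrite !ler_int in k1 k2.
have : [\/ k = -1, k = 0 | k = 1].
  case: k k1 k2 {ak} => [[|[|k]]|[|k]] // _ _; [exact: Or32|exact: Or33|exact: Or31].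
case=> kE; rewrite kE ?mulrNz in ak; [apply: Or33|apply: Or31|apply: Or32]; try split; lra.
Qed.

Lemma side0 r : side 1 0 r = diag 2^-1 (2^-1 - r).
Proof. by rewrite /side vertex0 vertex1 !row2Z row2D /diag; congr row2; field. Qed.

Lemma side1 r : side 1 1 r = diag (2^-1 - r) (- 2^-1).
Proof. by rewrite /side vertex1 vertex2 !row2Z row2D /diag; congr row2; field. Qed.

Lemma side2 r : side 1 2 (1 - r) = diag (- 2^-1) (2^-1 - r).
Proof. by rewrite /side vertex2 vertex3 !row2Z row2D /diag; congr row2; field. Qed.

Lemma side3 r : side 1 3 (1 - r) = diag (2^-1 - r) 2^-1.
Proof. by rewrite /side vertex3 vertex4 !row2Z row2D /diag; congr row2; field. Qed.

Local Notation glued := (clos_refl_sym_trans _ (@side_pairing R 1)).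

Lemma glued_a s : half s -> glued (diag 2^-1 s) (diag (- 2^-1) s).
Proof.
move=> /andP[s1 s2]; apply: rst_step.
have -> : s = 2^-1 - (2^-1 - s) by ring.
rewrite -side0 -side2; apply: (@pair_a R 1 0) => //; apply/andP; split; lra.
Qed.

Lemma glued_b s : half s -> glued (diag s (- 2^-1)) (diag s 2^-1).
Proof.
move=> /andP[s1 s2]; apply: rst_step.
have -> : s = 2^-1 - (2^-1 - s) by ring.
rewrite -side1 -side3; apply: (@pair_b R 1 0) => //; apply/andP; split; lra.
Qed.

(** Equal classes are joined by changing one rotated coordinate at a time: each
    change is trivial or crosses from a side to the opposite one. *)
Lemma torus_genus : @has_genus R (@torus R 2) 1.
Proof.
split=> //; exists glue; split.
- have sc k : smooth_on setT (fun x : 'rV[R]_2 => x 0 k) by exact: smooth_on_coord.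
  have sh : @smooth_on R 2 R setT (fun=> 2^-1) by apply: smooth_on_cst.
  have oT := @openT 'rV[R]_2.
  pose f (x : 'rV[R]_2) : 'rV[R]_2 := row2 ((x 0 0 + x 0 1) / 2) ((x 0 0 - x 0 1) / 2).
  have sf : smooth_on setT f.
    apply: smooth_on_mx => // i j; case j0 : (j == 0).
      rewrite (_ : (fun x => f x i j) = (fun x => (x 0 0 + x 0 1) / 2)).
        by apply: smooth_onM => //; apply: smooth_onD.
      by apply/funext => x; rewrite mxE j0.
    rewrite (_ : (fun x => f x i j) = (fun x => (x 0 0 - x 0 1) / 2)).
      by apply: smooth_onM => //; apply: smooth_onB.
    by apply/funext => x; rewrite mxE j0.
  have cg : continuous (@proj R 2 \o f).
    move=> x; apply: continuous_comp; last exact: proj_continuous.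
    exact: (@differentiable_continuous R _ _ x f (sf [::] x I)).
  by apply: continuous_subspaceT; apply: cg.
- apply/seteqP; split=> // p _.
  have hw t : half (wrap 0 t).
    by have /andP[] := wrap_bounds 0 t; rewrite sub0r add0r => a1 /ltW a2; apply/andP.
  exists (diag (wrap 0 (lift p 0 0)) (wrap 0 (lift p 0 1))).
    apply/polygon_diag; have [-> ->] :=
      half_diag (wrap 0 (lift p 0 0)) (wrap 0 (lift p 0 1)).
    by rewrite !hw.
  rewrite glue_diag -[RHS]liftK [in RHS](row2_eta (lift p)); apply/proj_row2.
  by rewrite !wrap_int.
- suff H a b a' b' : half a -> half b -> half a' -> half b' ->
      (glue (diag a b) = glue (diag a' b') <-> glued (diag a b) (diag a' b')).
    move=> x y /polygon_diag/andP[hx1 hx2] /polygon_diag/andP[hy1 hy2].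
    by have := H _ _ _ _ hx1 hx2 hy1 hy2; rewrite -!diag_eta.
  move=> ha hb ha' hb'.
  rewrite !glue_diag; split.
    move=> /proj_row2/andP[aa bb].
    apply: (@rst_trans _ _ _ (diag a' b)).
      case: (half_int ha ha' aa) => [->|[-> ->]|[-> ->]]; first exact: rst_refl.
        exact: glued_a.
      by apply: rst_sym; apply: glued_a.
    case: (half_int hb hb' bb) => [->|[-> ->]|[-> ->]]; first exact: rst_refl.
      by apply: rst_sym; apply: glued_b.
    exact: glued_b.
  rewrite -!glue_diag; elim=> [x y|//|x y _ ->//|x y z _ -> _ ->//].
  case=> [[|//] r _ r01|[|//] r _ r01].
    rewrite side0 side2 !glue_diag; apply/proj_row2; rewrite subrr rpred0 andbT opprK.
    have -> : 2^-1 + 2^-1 = 1 :> R by field.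
by rewrite rpred1.
  rewrite side1 side3 !glue_diag; apply/proj_row2; rewrite subrr rpred0 /= -opprD rpredN.
  have -> : 2^-1 + 2^-1 = 1 :> R by field.
by rewrite rpred1.
Qed.

Lemma torus_surface : closed_oriented_surface (@tatlas R 2) 1.
Proof.
split; [exact: torus_closed|exact: torus_oriented|exact: torus_connected|exact:
  torus_genus].
Qed.
End Genus.

(** * Periodic measures and fundamental domains *)

Section PeriodicMeasure.
Context d (T : measurableType d) {R : realType}.
Context (mu : {measure set T -> \bar R}) (f : T -> R) (tau : int -> T -> T) (X : set T).
Context (mf : measurable_fun setT f) (mX : measurable X).
Context (tauX : forall k, tau k @^-1` X = X) (ftau : forall k z, f (tau k z) = f z + k%:~R).
Context (mu_tau : forall k Y, measurable Y -> mu (tau k @^-1` Y) = mu Y).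

Let I (u v : R) := X `&` f @^-1` `[u, v[%classic.

Let mI u v : measurable (I u v).
Proof. by apply: measurableI => //; rewrite -[X in measurable X]setTI; apply: mf. Qed.

Let muI_shift u v k : mu (I (u + k%:~R) (v + k%:~R)) = mu (I u v).
Proof.
rewrite -(mu_tau k (mI _ _)); congr (mu _).
rewrite /I preimage_setI tauX; congr (_ `&` _).
by apply/seteqP; split=> z; rewrite /= !in_itv /= ftau lerD2r ltrD2r.
Qed.

Let muI_cat u v w : u <= v -> v <= w -> mu (I u w) = (mu (I u v) + mu (I v w))%E.
Proof.
move=> uv vw; rewrite -measureU //; first congr (mu _).
- rewrite /I -setIUr; congr (_ `&` _); apply/seteqP; split=> z; rewrite /= !in_itv /=.
    by move=> /andP[uz zw]; case: (ltP (f z) v) => zv; [left|right]; rewrite ?uz ?zw.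
  case=> /andP[h1 h2]; apply/andP; split=> //; first exact: lt_le_trans h2 vw.
  exact: le_trans uv h1.
- apply/seteqP; split=> // z [[_ h1] [_ h2]]; move: h1 h2; rewrite /= !in_itv /=.
  by move=> /andP[_ h1] /andP[h2 _]; move: (lt_le_trans h1 h2); rewrite ltxx.
Qed.

(** With n the integer part of [a], the part of the interval beyond n + 1 is moved
    back by one to complete [n, n + 1[, and this interval is moved to the origin. *)
Lemma fundamental_domain a :
  mu (X `&` f @^-1` `[a, a + 1[%classic) = mu (X `&` f @^-1` `[0, 1[%classic).
Proof.
rewrite -!/(I _ _); set n := Num.floor a.
have /andP[na an] := floor_itv a; rewrite -/n intrD in na an.
rewrite (@muI_cat a (n%:~R + 1) (a + 1)) ?lerD2r ?(ltW an) //.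
have := muI_shift n%:~R a 1; rewrite /= => ->.
rewrite addeC -muI_cat ?(ltW an) //.
by have := muI_shift 0 1 n; rewrite add0r addrC.
Qed.
End PeriodicMeasure.

Lemma ex_pushforward d1 d2 (T1 : measurableType d1) (T2 : measurableType d2)
    (R : realType) (mu : {measure set T1 -> \bar R}) (f : T1 -> T2) :
  measurable_fun setT f ->
  exists nu : {measure set T2 -> \bar R}, forall A, nu A = mu (f @^-1` A).
Proof.
move=> mf; suff [nu nuE] : exists nu : {measure set T2 ->
  \bar R}, nu = pushforward mu f :> (set T2 -> \bar R).
  by exists nu => A; rewrite nuE.
unshelve refine (ex_intro _ _ (erefl (pushforward mu f : set T2 -> \bar R))).
exact: mf.
Qed.

Section PlaneMeasure.
Context {R : realType}.
Local Notation T := (measurableTypeR R).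
Local Notation lambda := (@lebesgue_measure R).
Local Notation lambda2 := (lambda \x lambda)%E.

(** An open set of the plane is the union of the rational boxes that it contains. *)
Lemma open_measurable_prod (U : set (R * R)) : open U -> measurable (U : set (T * T)).
Proof.
move=> oU.
pose box (q : (rat * rat) * (rat * rat)) : set (R * R) :=
  `]ratr q.1.1, ratr q.1.2[%classic `*` `]ratr q.2.1, ratr q.2.2[%classic.
pose F q := if pselect (box q `<=` U) then box q else set0.
have -> : U = \bigcup_q F q.
  apply/seteqP; split=> [[x y] Uxy|z [q _]]; last first.
    by rewrite /F; case: pselect => // qU; apply: qU.
  move: oU; rewrite openE => /(_ _ Uxy); rewrite /interior => /nbhs_ballP[e /= e0 eU].
  have /rat_in_itvoo[p1] : x - e < x by lra.
  have /rat_in_itvoo[p2] : x < x + e by lra.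
  have /rat_in_itvoo[q1] : y - e < y by lra.
  have /rat_in_itvoo[q2] : y < y + e by lra.
  rewrite !in_itv /= => /andP[a1 a2] /andP[b1 b2] /andP[c1 c2] /andP[d1 d2].
  exists ((p1, p2), (q1, q2)) => //; rewrite /F; case: pselect => /= [H|[]].
    by split; rewrite /= in_itv /= ?d2 ?c1 ?b2 ?a1.
  move=> [x' y'] [] /=; rewrite !in_itv /= => /andP[h1 h2] /andP[h3 h4]; apply: eU.
  by split; rewrite /ball /= ltr_distl; apply/andP; split; lra.
apply: (@countable_bigcupT_measurable _ (T * T)%type); first exact: countableP.
by move=> q; rewrite /F; case: pselect => //= H; apply: (@measurableX _ _ T T);
  apply: measurable_itv.
Qed.

Definition translate (v z : R * R) : T * T := (z.1 + v.1, z.2 + v.2).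

Lemma measurable_translate v : measurable_fun setT (translate v : T * T -> T * T).
Proof.
apply/measurable_fun_pairP; split=> /=.
  by apply: measurable_funD => //; apply: measurable_fst.
by apply: measurable_funD => //; apply: measurable_snd.
Qed.

Lemma lebesgue_measure_translate (k : R) (A : set R) : measurable (A : set T) ->
  lambda ((fun x => x + k) @^-1` A) = lambda A.
Proof.
have mk : measurable_fun setT (fun x : T => (x + k : T)) by apply: measurable_funD.
have [m mE] := ex_pushforward lambda mk.
move=> mA; rewrite -mE; apply/esym;
  apply: (@lebesgue_measure_unique R m) => // _ [[a b]] _ <-.
rewrite mE /=.
have -> : (fun x : T => x + k : T) @^-1` `]a, b]%classic = `]a - k, b - k]%classic.
  by apply/seteqP; split=> x; rewrite /= !in_itv /= ltrBlDr lerBrDr.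
rewrite !lebesgue_measure_itv /= !lte_fin ltrD2r; case: ifP => // _.
by rewrite -!EFinB; congr (_%:E); ring.
Qed.

(** By uniqueness of the product measure it is enough to treat rectangles. *)
Lemma lebesgue_measure2_translate v (X : set (T * T)) : measurable X ->
  lambda2 (translate v @^-1` X) = lambda2 X.
Proof.
move=> mX; have mv := measurable_translate v.
have [m mE] := ex_pushforward lambda2 mv.
rewrite -mE; apply/esym; apply: (@product_measure_unique _ _ T T R lambda lambda m) =>
  //= A B mA mB.
rewrite mE.
have -> : translate v @^-1` (A `*` B) =
    ((fun x : T => x + v.1 : T) @^-1` A) `*` ((fun x : T => x + v.2 : T) @^-1` B) by [].
have mt (k : R) (C : set T) : measurable C -> measurable ((fun x : T => x + k : T) @^-1` C).
  move=> mC; rewrite -[X in measurable X]setTI.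
  have mk : measurable_fun setT (fun x : T => (x + k : T)) by apply: measurable_funD.
  exact: mk.
apply: etrans; first by apply: (@product_measure1E _ _ T T R lambda lambda); apply: mt.
by congr (_ * _)%E; apply: lebesgue_measure_translate.
Qed.

(** One coordinate is shifted at a time, the constraint on the other coordinate being
    part of the periodic set. *)
Lemma fundamental_square (P : set (T * T)) a b : measurable P ->
  (forall k l : int, translate (k%:~R, l%:~R) @^-1` P = P) ->
  lambda2 (P `&` (`[a, a + 1[%classic `*` `[b, b + 1[%classic)) =
  lambda2 (P `&` (`[0, 1[%classic `*` `[0, 1[%classic)).
Proof.
move=> mP perP.
have m1 : measurable_fun setT (fst : T * T -> R) by apply: measurable_fst.
have m2 : measurable_fun setT (snd : T * T -> R) by apply: measurable_snd.
have mI (f : T * T -> R) : measurable_fun setT f ->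
  forall u v, measurable (P `&` f @^-1` `[u, v[%classic).
  by move=> mf u v; apply: measurableI => //; rewrite -[X in measurable X]setTI; apply: mf.
have E u v u' v' : P `&` (`[u, v[%classic `*` `[u', v'[%classic) =
    (P `&` snd @^-1` `[u', v'[%classic) `&` fst @^-1` `[u, v[%classic.
  by rewrite -setIA; congr (_ `&` _); rewrite setIC.
have E' u v u' v' : P `&` (`[u, v[%classic `*` `[u', v'[%classic) =
    (P `&` fst @^-1` `[u, v[%classic) `&` snd @^-1` `[u', v'[%classic.
  by rewrite -setIA.
rewrite E (@fundamental_domain _ _ R lambda2 fst (fun k => translate (k%:~R, 0))) //;
  first last.
- by move=> k Y mY; apply: lebesgue_measure2_translate.
- move=> k; rewrite preimage_setI (perP k 0); congr (_ `&` _).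
  by apply/seteqP; split=> z; rewrite /= addr0.
- exact: mI.
rewrite -E E' (@fundamental_domain _ _ R lambda2 snd (fun k => translate (0, k%:~R))) //;
  first last.
- by move=> k Y mY; apply: lebesgue_measure2_translate.
- move=> k; rewrite preimage_setI (perP 0 k); congr (_ `&` _).
  by apply/seteqP; split=> z; rewrite /= addr0.
- exact: mI.
by rewrite -E'.
Qed.
End PlaneMeasure.

(** * The flat torus of unit area *)

Section TorusArea.
Context {R : realType}.
Local Notation T := (measurableTypeR R).
Local Notation lambda := (@lebesgue_measure R).
Local Notation lambda2 := (lambda \x lambda)%E.
Local Notation T2 := (@torus R 2).

Definition flat_metric m : @tensor R (@torus R m) m := invariant_tensor (fun=> 1%:M).

Definition plane (z : R * R) : T2 := proj (row2 z.1 z.2).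

Lemma plane_continuous : continuous plane.
Proof.
have cr : continuous (fun z : R * R => row2 z.1 z.2).
  have -> : (fun z : R * R => row2 z.1 z.2) =
            (fun z : R * R => z.1 *: (row2 1 0 : 'rV[R]_2) + z.2 *: (row2 0 1 : 'rV[R]_2)).
    apply/funext => z; apply/rowP => i; rewrite !mxE.
    by case: ifP => _; rewrite mulr1 mulr0 ?addr0 ?add0r.
  move=> z; apply: cvgD; apply: cvgZr_tmp; [exact: cvg_fst|exact: cvg_snd].
move=> z; apply: (@continuous_comp _ _ _ (fun z : R * R => row2 z.1 z.2) (@proj R 2)).
  exact: cr.
exact: proj_continuous.
Qed.

Lemma measurable_plane : measurable_fun setT (plane : T * T -> borel T2).
Proof.
apply: (@measurability _ _ (T * T)%type (borel T2) setT plane (@open T2)) => // _ [U oU <-].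
rewrite setTI.
apply: open_measurable_prod.
by move/continuousP : plane_continuous; apply.
Qed.

Lemma plane_periodic (B : set T2) (k l : int) :
  translate (k%:~R, l%:~R) @^-1` (plane @^-1` B) = plane @^-1` B.
Proof.
apply/seteqP; split=> z; rewrite /= /plane /=;
  (suff -> : proj (row2 (z.1 + k%:~R) (z.2 + l%:~R)) = proj (row2 z.1 z.2) :> T2 by []);
  by apply/proj_row2; rewrite !(addrAC _ _ (- _)) !subrr !add0r !intr_int.
Qed.

(** The area is the image of Lebesgue measure on the unit square. A chart uses the
    unit square around another point, which is again a fundamental domain: the chart
    image of a subset of its domain is the periodic lift cut by this square. *)
Lemma torus_area : exists mu : {measure set (borel T2) -> \bar R},
  is_area (@tatlas R 2) (@flat_metric 2) mu /\ mu setT = 1%E.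
Proof.
pose D0 : set (T * T) := `[0%R, 1%R[%classic `*` `[0%R, 1%R[%classic.
have mD0 : measurable D0 by apply: (@measurableX _ _ T T); apply: measurable_itv.
have [mu muE] := ex_pushforward (mrestr lambda2 mD0) measurable_plane.
have mu0 A : mu A = lambda2 (plane @^-1` A `&` D0) by rewrite muE.
exists mu; split; last first.
  rewrite mu0 preimage_setT setTI; apply: etrans.
    by apply: (@product_measure1E _ _ T T R lambda lambda); apply: measurable_itv.
  by rewrite /= !lebesgue_measure_itv /= lte_fin ltr01 oppr0 adde0 mule1.
move=> _ B [a _ <-] mB Ba.
have mPB : measurable (plane @^-1` B : set (T * T)).
  by rewrite -[X in measurable X]setTI; apply: measurable_plane.
have -> : (fun z : R * R => (cmap (tchart a) @` B) (row2 z.1 z.2)) =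
   plane @^-1` B `&` (`[a 0 0 - 2^-1, a 0 0 - 2^-1 + 1[%classic `*`
                      `[a 0 1 - 2^-1, a 0 1 - 2^-1 + 1[%classic).
  have e (t : R) : t - 2^-1 + 1 = t + 2^-1 by field.
  apply/seteqP; split=> [[x y] /= [p Bp rp]|[x y] /= [Bp []]].
    have h i := wrap_bounds (a 0 i) (lift p 0 i).
    move/rowP : (rp) => rpE; split; first by rewrite /plane /= -rp proj_rep liftK.
    by rewrite /= !in_itv /= !e; split; [have := rpE 0; rewrite row2E0|have := rpE 1;
      rewrite row2E1];
      rewrite mxE => <-; apply: h.
  rewrite !in_itv /= !e => hx hy; exists (plane (x, y)) => //.
  rewrite /plane rep_lift; apply/rowP => i; rewrite !mxE.
  case: eqP => [->|/eqP i0]; first by rewrite wrap_id.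
  have -> : i = 1 by apply/val_inj; case: i i0 => -[|[|]].
  by rewrite wrap_id.
set S := _ `&` _; have mS : measurable (S : set (T * T)).
  by apply: measurableI => //; apply: (@measurableX _ _ T T); apply: measurable_itv.
rewrite (eq_integral (cst 1%E)); last first.
  move=> z _; rewrite /local /flat_metric invariant_tensor_atlas ?det1 ?sqrtr1 //.
  by exists a.
rewrite integral_cst // mul1e mu0; apply/esym.
apply: (@fundamental_square R (plane @^-1` B) (a 0 0 - 2^-1) (a 0 1 - 2^-1) mPB) => k l.
exact: plane_periodic.
Qed.

Lemma pd_cst m (V : normedModType R) (a : V) i : pd i (fun _ : 'rV[R]_m => a) = fun=> 0.
Proof. by apply/funext => x; apply: derive_cst. Qed.

Lemma christoffel_cst m (G : 'M[R]_m) k i j : christoffel (fun=> G) k i j = fun=> 0.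
Proof.
apply/funext => x; rewrite /christoffel big1 ?mulr0 // => l _.
by rewrite !pd_cst addr0 subr0 mulr0.
Qed.

Lemma flat_metric_local m (c : chart R (torus m) m) : tatlas c ->
  local (@flat_metric m) c = fun=> 1%:M.
Proof. by move=> Ac; apply/funext => x;
  rewrite /local /flat_metric invariant_tensor_atlas. Qed.

Lemma pos_def_diag m (d : 'rV[R]_m) : (forall i, 0 < d 0 i) -> pos_def (diag_mx d).
Proof.
move=> d0; split; first by rewrite tr_diag_mx.
move=> v v0; rewrite mxE.
have [i vi] : exists i, v 0 i != 0.
  by apply/existsP; apply: contra_neqT v0; rewrite negb_exists => /forallP H;
    apply/rowP => i; rewrite mxE; have := H i; rewrite negbK => /eqP.
have E j : (v *m diag_mx d) 0 j * v^T j 0 = d 0 j * v 0 j ^+ 2.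
  by rewrite mul_mx_diag !mxE; ring.
under eq_bigr do rewrite E.
rewrite (bigD1 i) //= ltr_pwDl //; first by rewrite mulr_gt0 // exprn_even_gt0.
by rewrite sumr_ge0 // => j _; rewrite mulr_ge0 ?sqr_ge0 // ltW.
Qed.

Lemma pos_def1 m : pos_def (1%:M : 'M[R]_m).
Proof. by rewrite -diag_const_mx; apply: pos_def_diag => i; rewrite mxE ltr01. Qed.

Lemma flat_in_Mc : in_Mc (@tatlas R 2) 1 (@flat_metric 2).
Proof.
split.
- apply: invariant_tensor_riemannian => [p|]; first exact: pos_def1.
  exact: smooth_on_cst.
- move=> c p Ac cp; rewrite flat_metric_local // eqxx /gauss_curvature.
  rewrite big1 ?mul0r // => l _; rewrite !christoffel_cst !pd_cst subr0 add0r.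
  by rewrite big1 ?mulr0 // => k _; rewrite !christoffel_cst !mul0r subr0.
- by move=> _; have [mu [amu mu1]] := torus_area; exists mu.
Qed.
End TorusArea.

(** * The potential with a spiralling gradient line *)

Section SmoothProfile.
Context {R : realType}.
Implicit Types (x y t : R).

Definition expflat : R -> R := flat 1 0 0.
Definition expcos : R -> R := flat 0 1 0.
Definition expsin : R -> R := flat 0 0 1.

Lemma expflatE y : 0 < y -> expflat y = expR (- y^-1).
Proof. by move=> y0; rewrite /expflat /flat y0 /decay !hornerE /= ?(mul0r, mul1r, addr0,
  add0r, mulr1). Qed.

Lemma expcosE y : 0 < y -> expcos y = expR (- y^-1) * cos y^-1.
Proof. by move=> y0; rewrite /expcos /flat y0 /decay !hornerE /= ?(mul0r, mul1r, addr0,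
  add0r, mulr1). Qed.

Lemma expsinE y : 0 < y -> expsin y = expR (- y^-1) * sin y^-1.
Proof. by move=> y0; rewrite /expsin /flat y0 /decay !hornerE /= ?(mul0r, mul1r, addr0,
  add0r, mulr1). Qed.

Lemma flat_le0 p q r y : y <= 0 -> flat p q r y = 0 :> R.
Proof. by move=> y0; rewrite /flat ltNge y0. Qed.

Lemma expflat_ge0 y : 0 <= expflat y.
Proof.
case: (ltP 0 y) => y0; last by rewrite /expflat flat_le0.
by rewrite expflatE // expR_ge0.
Qed.

(** A smooth transition from 0 on ]-oo, 0] to 1 on [1, +oo[. *)
Definition step x : R := expflat x / (expflat x + expflat (1 - x)).

Lemma step_den x : 0 < expflat x + expflat (1 - x).
Proof.
case: (ltP 0 x) => x0.
  by rewrite ltr_pwDl ?expflat_ge0 // expflatE // expR_gt0.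
by rewrite ltr_wpDl ?expflat_ge0 // expflatE ?expR_gt0 //; lra.
Qed.

Lemma step1 x : 1 <= x -> step x = 1.
Proof.
move=> x1; have := step_den x; rewrite /step [expflat (1 - x)]flat_le0; last by lra.
by rewrite addr0 => /lt0r_neq0 h; rewrite divff.
Qed.

Lemma step0 x : x <= 0 -> step x = 0.
Proof. by move=> x0; rewrite /step [expflat x]flat_le0 // mul0r. Qed.

Lemma step_ge0 x : 0 <= step x.
Proof. by rewrite divr_ge0 ?expflat_ge0 // ltW // step_den. Qed.

Lemma step_le1 x : step x <= 1.
Proof. by rewrite ler_pdivrMr ?step_den // mul1r lerDl expflat_ge0. Qed.

Definition bump y : R := y * step (2 - 16 * y ^+ 2).

Lemma bump_id y : `|y| <= 4^-1 -> bump y = y.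
Proof.
move=> y4; rewrite /bump step1 ?mulr1 //.
have : `|y| ^+ 2 <= 4^-1 ^+ 2 by rewrite lerXn2r // ?nnegrE //; lra.
by rewrite real_normK ?num_real //; lra.
Qed.

Lemma bump_far y : 3 / 8 <= `|y| -> bump y = 0.
Proof.
move=> y4; rewrite /bump step0 ?mulr0 //.
have : (3 / 8) ^+ 2 <= `|y| ^+ 2 by rewrite lerXn2r // ?nnegrE //; lra.
by rewrite real_normK ?num_real //; lra.
Qed.

Lemma bump_le y : `|bump y| <= `|y|.
Proof. by rewrite normrM ler_piMr // ger0_norm ?step_ge0 // step_le1. Qed.

(** The function Y: smooth, of period one, and equal to the signed distance to the
    nearest integer where this is small, so that formulas in a real variable make
    sense on the circle. *)
Definition height y : R := bump (wrap 0 y).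

Lemma height_congr y y' : y - y' \is a Num.int -> height y = height y'.
Proof. by move=> yy'; rewrite /height (wrap_congr 0 yy'). Qed.

Lemma height_id y y' : `|y| <= 4^-1 -> y' - y \is a Num.int -> height y' = y.
Proof.
move=> y4 yy'; rewrite (height_congr yy') /height wrap_id ?bump_id //.
by move: y4; rewrite ler_norml => /andP[h1 h2]; apply/andP; split; lra.
Qed.

Lemma height_bound y : `|height y| <= 2^-1.
Proof.
apply: le_trans (bump_le _) _; have /andP[h1 /ltW h2] := wrap_bounds 0 y.
by rewrite ler_norml -(add0r (- _)) h1 -[2^-1]add0r.
Qed.

Section SmoothComp.
Context {m : nat} (U : set 'rV[R]_m) (oU : open U).

Lemma smooth_flat p q r (f : 'rV[R]_m -> R) : smooth_on U f ->
  smooth_on U (fun z => flat p q r (f z)).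
Proof. by move=> sf; apply: (smooth_on_comp (I := setT)) => //; apply: smooth1_flat. Qed.

Lemma smooth_bump (f : 'rV[R]_m -> R) : smooth_on U f -> smooth_on U (fun z => bump (f z)).
Proof.
move=> sf; have cs (c : R) : smooth_on U (fun=> c) by apply: smooth_on_cst.
have se g : smooth_on U g -> smooth_on U (fun z => expflat (g z)) by apply: smooth_flat.
have sg : smooth_on U (fun z => 2 - 16 * f z ^+ 2).
  by apply: smooth_onB => //; apply: smooth_onM => //; apply: smooth_onX.
apply: smooth_onM => //; apply: smooth_onM => //; first exact: se.
apply: (smooth_on_comp (f := fun t => t^-1) oU smooth1_inv).
  by apply: smooth_onD => //; apply: se => //; apply: smooth_onB.
by move=> x _; rewrite /= gt_eqF // step_den.
Qed.
End SmoothComp.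

(** Off the cut the representative is locally a translate of the variable; near the
    cut it is close to 1/2 in absolute value, where [bump] vanishes. *)
Lemma smooth_height m (i : 'I_m) : smooth_on setT (fun x : 'rV[R]_m => height (x 0 i)).
Proof.
have oT := @openT 'rV[R]_m.
apply: near_smooth_on => x _; have /andP[w1 w2] := wrap_bounds 0 (x 0 i).
case: (ltP (0 - 2^-1) (wrap 0 (x 0 i))) => w3.
  exists setT, (fun z => bump (z 0 i + (wrap 0 (x 0 i) - x 0 i))); split => //.
    apply: smooth_bump => //; apply: smooth_onD => //; first exact: smooth_on_coord.
    exact: smooth_on_cst.
  by have /near_coord := near_wrap w3; apply: filterS => y; rewrite /height => ->.
exists setT, (fun=> 0); split => //; first exact: smooth_on_cst.
have /near_coord : \forall t \near x 0 i, t \in `](x 0 i - 8^-1), (x 0 i + 8^-1)[.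
  by apply: near_in_itvoo; rewrite in_itv /=; apply/andP; split; lra.
apply: filterS => y; rewrite in_itv /= => /andP[y1 y2].
rewrite /height bump_far //.
have /andP[v1 v2] := wrap_bounds 0 (y 0 i).
have : wrap 0 (y 0 i) - wrap 0 (x 0 i) - (y 0 i - x 0 i) \is a Num.int.
  have -> : wrap 0 (y 0 i) - wrap 0 (x 0 i) - (y 0 i - x 0 i) =
    (wrap 0 (y 0 i) - y 0 i) - (wrap 0 (x 0 i) - x 0 i) by ring.
  by apply: rpredB; apply: wrap_int.
move: w1 w2 w3 v1 v2; move: (wrap _ _) (wrap _ _) => v w w1 w2 w3 v1 v2 /intrP[k kE].
have k1 : (-1)%:~R < k%:~R :> R by rewrite mulrNz -kE; lra.
have k2 : k%:~R < 2%:~R :> R by rewrite -kE; lra.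
rewrite !ltr_int in k1 k2.
have [k0|k0] : k = 0 \/ k = 1.
  by case: k k1 k2 {kE} => [[|[|k]]|k] //; [left|right].
  by rewrite k0 in kE; rewrite ler0_norm; lra.
by rewrite k0 in kE; rewrite ger0_norm; lra.
Qed.

(** For Y > 0 this is exp(-1/Y) (1 - (1 - Y^4) sin(2 pi x - 1/Y)); the sine is expanded
    so that each term is a smooth function of [x] times a flat function of Y. *)
Definition potential x y : R := let Y := height y in
  expflat Y - (1 - Y ^+ 4) * (sin (2 * pi * x) * expcos Y - cos (2 * pi * x) * expsin Y).

Lemma potentialE x y : 0 < height y -> potential x y =
  expR (- (height y)^-1) * (1 - (1 - height y ^+ 4) * sin (2 * pi * x - (height y)^-1)).
Proof.
move=> Y0; rewrite /potential expflatE // expcosE // expsinE // sinD sinN cosN; ring.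
Qed.

Lemma height4 y : 0 <= height y ^+ 4 < 1.
Proof.
apply/andP; split; first by rewrite (exprM _ 2 2) sqr_ge0.
have := height_bound y; rewrite ler_norml; move: (height y) => z /andP[z1 z2].
have z3 : z ^+ 2 <= 4^-1 by nra.
have : 0 <= z ^+ 2 by rewrite sqr_ge0.
have -> : z ^+ 4 = z ^+ 2 * z ^+ 2 by ring.
move: (z ^+ 2) z3 => w w1 w0; nra.
Qed.

(** For Y > 0 the second factor is at least 1 - (1 - Y^4), the sine being at most one. *)
Lemma potential_ge0 x y : 0 <= potential x y.
Proof.
case: (ltP 0 (height y)) => Y0; last first.
  by rewrite /potential /expflat /expcos /expsin !flat_le0 // !mulr0 subr0 mulr0 subr0.
rewrite potentialE // mulr_ge0 ?expR_ge0 //.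
have /andP[h0 /ltW h1] := height4 y; rewrite subr_ge0.
have := sin_le1 (2 * pi * x - (height y)^-1); move: (sin _) => s s1.
have : (1 - height y ^+ 4) * s <= (1 - height y ^+ 4) * 1 by rewrite ler_wpM2l //; lra.
by lra.
Qed.

Lemma sincos_int x (k : int) : sin (x + 2 * pi * k%:~R) = sin x /\ cos (x + 2 * pi *
  k%:~R) = cos x.
Proof.
have pn (n : nat) t : sin (t + 2 * pi * n%:R) = sin t /\ cos (t + 2 * pi * n%:R) = cos t.
  have -> : 2 * pi * n%:R = (pi *+ 2) *+ n :> R.
    by rewrite -(mulr_natr (pi *+ 2) n) -(mulr_natr pi 2); ring.
  by rewrite (periodicn (@sinD2pi R)) (periodicn (@cosD2pi R)).
case: k => n; first exact: pn.
have [h1 h2] := pn n.+1 (x + 2 * pi * (Negz n)%:~R).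
rewrite -h1 -h2; suff -> : x + 2 * pi * (Negz n)%:~R + 2 * pi * n.+1%:R = x by [].
by rewrite NegzE mulrNz -pmulrn; ring.
Qed.

Lemma potential_congr x y x' y' : x - x' \is a Num.int -> y - y' \is a Num.int ->
  potential x y = potential x' y'.
Proof.
move=> /intrP[k xk] yy; rewrite /potential (height_congr yy).
have -> : 2 * pi * x = 2 * pi * x' + 2 * pi * k%:~R by rewrite -xk; ring.
by have [-> ->] := sincos_int (2 * pi * x') k.
Qed.

(** On the curve 2 pi x = 1/y = t the sine vanishes and its cosine is one. With the
    derivative in the other variable below, the gradient for the metric
    4 pi^2 (1 - y^4) dx^2 + dy^2 is - e^-t (1/(2 pi), - 1/t^2), which is tangent to the
    curve (t/(2 pi), 1/t): the factor 1 - Y^4 is chosen for that. *)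
Lemma potential_dx x y t (k l : int) : 4 <= t -> x = t / (2 * pi) + k%:~R ->
  y = t^-1 + l%:~R ->
  isD (fun s => potential (s + x) y) 0 (- (2 * pi) * (1 - height y ^+ 4) * expR (- t)).
Proof.
move=> t4 xE yE; have t0 : 0 < t by lra.
have hY : height y = t^-1.
  apply: height_id; last by rewrite yE addrAC subrr add0r intr_int.
  by rewrite ger0_norm ?lef_pV2 ?posrE // invr_ge0 ltW.
have Y0 : 0 < height y by rewrite hY invr_gt0.
apply: isD_eq.
  have -> : (fun s => potential (s + x) y) = (fun s => expR (- (height y)^-1) *
     (1 - (1 - height y ^+ 4) * sin (2 * pi * (s + x) - (height y)^-1))).
    by apply/funext => s; rewrite potentialE.
  apply: isDM; first exact: isD_cst.
  apply: isDB; first exact: isD_cst.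
  apply: isDM; first exact: isD_cst.
  apply: (@isD_comp _ sin); first exact: isD_sin.
  apply: isDB; last exact: isD_cst.
  apply: isDM; first exact: isD_cst.
  by apply: isDD; [exact: isD_id|exact: isD_cst].
rewrite /= hY invrK add0r xE.
have -> : 2 * pi * (t / (2 * pi) + k%:~R) - t = 0 + 2 * pi * k%:~R.
  have pi0 : pi != 0 :> R by rewrite gt_eqF // pi_gt0.
  by move: (pi : R) pi0 => p p0; field.
have [-> ->] := sincos_int 0 k; rewrite sin0 cos0; ring.
Qed.

Lemma potential_dy x y t (k l : int) : 4 < t -> x = t / (2 * pi) + k%:~R ->
  y = t^-1 + l%:~R ->
  isD (fun s => potential x (s + y)) 0 (expR (- t) * t ^- 2).
Proof.
move=> t4 xE yE; have t0 : 0 < t by lra.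
have t0' : t != 0 by rewrite gt_eqF.
have ti0 : 0 < t^-1 by rewrite invr_gt0.
have ti4 : t^-1 < 4^-1 by rewrite ltf_pV2 ?posrE.
pose G s := expR (- (s + t^-1)^-1) * (1 - (1 - (s + t^-1) ^+ 4) * sin (2 * pi * x - (s +
  t^-1)^-1)).
have near0 : \forall s \near (0 : R), G s = potential x (s + y).
  have := @near_in_itvoo R (- t^-1) (4^-1 - t^-1) 0.
  rewrite in_itv /= => /(_ _)H.
  have : (\forall z \near (0:R), z \in `](- t^-1), (4^-1 - t^-1)[) by apply: H;
    apply/andP; split; lra.
  apply: filterS => s; rewrite in_itv /= => /andP[s1 s2].
  have hs : height (s + y) = s + t^-1.
    apply: height_id; first by rewrite ger0_norm; lra.
    have -> : s + y - (s + t^-1) = l%:~R by rewrite yE; ring.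
    exact: intr_int.
  by rewrite potentialE hs //; lra.
apply: (near_eq_is_derive near0).
have D1 : isD (fun s : R => s + t^-1) 0 1.
  by apply: isD_eq; first (by apply: isDD; [exact: isD_id|exact: isD_cst]); rewrite addr0.
have DV : isD (fun s : R => (s + t^-1)^-1) 0 (- t ^+ 2).
  apply: isD_eq; first by apply: isDV; [rewrite add0r invr_neq0|exact: D1].
  by rewrite /= add0r invrK mulr1.
rewrite -/(isD G 0 _); apply: isD_eq.
  apply: isDM.
    apply: (@isD_comp _ expR (fun s => - (s + t^-1)^-1)); first exact: isD_expR.
    by apply: isDN; exact: DV.
  apply: isDB; first exact: isD_cst.
  apply: isDM.
    apply: isDB; first exact: isD_cst.
    by apply: isDX; exact: D1.
  apply: (@isD_comp _ sin (fun s => 2 * pi * x - (s + t^-1)^-1)); first exact: isD_sin.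
  by apply: isDB; [exact: isD_cst|exact: DV].
rewrite /= !add0r !invrK xE.
have -> : 2 * pi * (t / (2 * pi) + k%:~R) - t = 0 + 2 * pi * k%:~R.
  have pi0 : pi != 0 :> R by rewrite gt_eqF // pi_gt0.
  by move: (pi : R) pi0 => p p0; field.
have [-> ->] := sincos_int 0 k; rewrite sin0 cos0; field.
exact: t0'.
Qed.
End SmoothProfile.

(** * The warped metric on the four-dimensional torus *)

Section Target.
Context {R : realType}.

Definition i0 : 'I_4 := @Ordinal 4 0 isT.
Definition i1 : 'I_4 := @Ordinal 4 1 isT.
Definition i2 : 'I_4 := @Ordinal 4 2 isT.
Definition i3 : 'I_4 := @Ordinal 4 3 isT.

Lemma ord4 (P : 'I_4 -> Prop) : P i0 -> P i1 -> P i2 -> P i3 -> forall j, P j.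
Proof.
move=> h0 h1 h2 h3 [[|[|[|[|j]]]] Hj] //.
- by rewrite (_ : Ordinal _ = i0) //; apply/val_inj.
- by rewrite (_ : Ordinal _ = i1) //; apply/val_inj.
- by rewrite (_ : Ordinal _ = i2) //; apply/val_inj.
- by rewrite (_ : Ordinal _ = i3) //; apply/val_inj.
Qed.

Definition row4 (a b c d : R) : 'rV[R]_4 := \row_j nth 0 [:: a; b; c; d] j.

(** Reduces partial derivatives to the rules for one variable. *)
Lemma pd_line m (f : 'rV[R]_m -> R) i x l :
  isD (fun s => f (s *: delta_mx 0 i + x)) 0 l -> pd i f x = l.
Proof.
move=> [_ <-]; rewrite /pd /derive.
have -> : (fun h : R => h^-1 *: ((f \o shift x) (h *: delta_mx 0 i) - f x)) =
  (fun h : R => h^-1 *: (((fun s => f (s *: delta_mx 0 i + x)) \o shift 0) (h *: (1 : R)) -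
     f (0 *: delta_mx 0 i + x))); last by [].
have e (h : R) : h *: (1 : R) = h by apply: mulr1.
by apply/funext => h; rewrite /= e addr0 scale0r add0r.
Qed.

Lemma line_coord m (s : R) (i j : 'I_m) (x : 'rV[R]_m) :
  (s *: delta_mx 0 i + x) 0 j = s * (j == i)%:R + x 0 j.
Proof. by rewrite !mxE eqxx. Qed.

Lemma invmx_diag m (d : 'rV[R]_m) : (forall i, d 0 i != 0) ->
  invmx (diag_mx d) = diag_mx (\row_i (d 0 i)^-1).
Proof.
move=> d0; set B := diag_mx (\row_i _).
have AB : diag_mx d *m B = 1%:M.
  by rewrite mulmx_diag; apply/matrixP => i j; rewrite !mxE divff.
have [uA _] := mulmx1_unit AB.
by rewrite -[RHS](mulKmx uA) AB mulmx1.
Qed.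

(** The squared length of the third coordinate vector. *)
Definition weight (y : R) : R := (2 * pi) ^+ 2 * (1 - height y ^+ 4).

Lemma weight_gt0 y : 0 < weight y.
Proof.
have /andP[_ h] := height4 y; apply: mulr_gt0; last by lra.
by rewrite exprn_gt0 // mulr_gt0 // pi_gt0.
Qed.

Definition warp (y : 'rV[R]_4) : R := 1 + potential (y 0 i2) (y 0 i3).

Lemma warp_gt0 y : 0 < warp y.
Proof. by rewrite /warp ltr_pwDl // potential_ge0. Qed.

Definition wdiag (y : 'rV[R]_4) : 'rV[R]_4 := row4 (warp y) (warp y) (weight (y 0 i3)) 1.

Definition wmetric (y : 'rV[R]_4) : 'M[R]_4 := diag_mx (wdiag y).

Lemma wdiag_gt0 y j : 0 < wdiag y 0 j.
Proof. by move: j; apply: ord4; rewrite mxE /= ?warp_gt0 ?weight_gt0. Qed.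

Lemma wmetric_congr x y : lattice_eq x y -> wmetric x = wmetric y.
Proof.
move=> /lattice_eqP xy; rewrite /wmetric /wdiag /warp /weight.
by rewrite (potential_congr (xy i2) (xy i3)) (height_congr (xy i3)).
Qed.

Lemma smooth_wmetric : smooth_on setT wmetric.
Proof.
have oT := @openT 'rV[R]_4.
have cs (c : R) : smooth_on setT (fun=> c : R) by move=> m; apply: smooth_on_cst.
have cs4 (c : R) : @smooth_on R 4 R setT (fun=> c) by apply: smooth_on_cst.
have sY := @smooth_height R 4 i3.
have sX : smooth_on setT (fun y : 'rV[R]_4 => 2 * pi * y 0 i2).
  by apply: smooth_onM => //; apply: smooth_on_coord.
have sf p q r : smooth_on setT (fun y : 'rV[R]_4 => flat p q r (height (y 0 i3))).
  by apply: smooth_flat.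
have s4 : smooth_on setT (fun y : 'rV[R]_4 => 1 - height (y 0 i3) ^+ 4).
  by apply: smooth_onB => //; apply: smooth_onX.
have ssin : smooth_on setT (fun y : 'rV[R]_4 => sin (2 * pi * y 0 i2)).
  by apply: (smooth_on_comp (I := setT)) => //; apply: smooth1_sin.
have scos : smooth_on setT (fun y : 'rV[R]_4 => cos (2 * pi * y 0 i2)).
  by apply: (smooth_on_comp (I := setT)) => //; apply: smooth1_cos.
have swarp : smooth_on setT warp.
  apply: smooth_onD => //; apply: smooth_onB => //; first exact: sf.
  apply: smooth_onM => //; apply: smooth_onB => //; apply: smooth_onM => //; exact: sf.
have sweight : smooth_on setT (fun y : 'rV[R]_4 => weight (y 0 i3)) by apply: smooth_onM.
have sd j : smooth_on setT (fun y => wdiag y 0 j).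
  move: j; apply: ord4; (apply: (eq_smooth_on oT); first by move=> y _;
    rewrite [RHS]mxE /=) => //.
apply: smooth_on_mx => // i j; have [->|ij] := eqVneq i j.
  by apply: eq_smooth_on oT _ (sd j) => y _; rewrite [RHS]mxE eqxx mulr1n.
by apply: eq_smooth_on oT _ (cs4 0) => y _; rewrite [RHS]mxE (negbTE ij) mulr0n.
Qed.

Definition warped : @tensor R (torus 4) 4 := invariant_tensor (fun p => wmetric (lift p)).

Lemma wmetric_lift y : wmetric (lift (proj y)) = wmetric y.
Proof. exact/wmetric_congr/lift_proj. Qed.

Lemma warped_local d : tatlas d -> local warped d = wmetric.
Proof.
move=> Ad; apply/funext => y; rewrite /local /warped invariant_tensor_atlas //.
by move: Ad => [b _ <-]; rewrite wmetric_lift.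
Qed.

Lemma warped_riemannian : riemannian_metric (@tatlas R 4) warped.
Proof.
apply: invariant_tensor_riemannian => [p|].
  by apply: pos_def_diag => j; apply: wdiag_gt0.
by under eq_fun do rewrite wmetric_lift; apply: smooth_wmetric.
Qed.

(** Since the metric is diagonal and its coefficients do not depend on the first two
    coordinates, only the derivative of the [i]-th diagonal entry, that is of the warping
    function, survives: one gets minus half of its gradient. *)
Lemma christoffel_warped (i a : 'I_4) (y : 'rV[R]_4) (d2 d3 : R) : (i < 2)%N ->
  isD (fun s => potential (s + y 0 i2) (y 0 i3)) 0 d2 ->
  isD (fun s => potential (y 0 i2) (s + y 0 i3)) 0 d3 ->
  christoffel wmetric a i i y = - 2^-1 * (wdiag y 0 a)^-1 * row4 0 0 d2 d3 0 a.
Proof.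
move=> i_lt D2 D3.
have wii z : wmetric z i i = warp z.
  by rewrite mxE eqxx mulr1n; move: i i_lt; apply: ord4 => // _; rewrite mxE.
have pdw j : pd j warp y = row4 0 0 d2 d3 0 j.
  apply: pd_line; rewrite /warp; apply: isD_eq; first (apply: isDD; first exact: isD_cst).
    2: exact: add0r.
  move: j; apply: ord4; rewrite mxE /=.
  - under eq_fun do rewrite !line_coord !mulr0 !add0r; exact: isD_cst.
  - under eq_fun do rewrite !line_coord !mulr0 !add0r; exact: isD_cst.
  - by under eq_fun do rewrite !line_coord !mulr0 !mulr1 !add0r.
  - by under eq_fun do rewrite !line_coord !mulr0 !mulr1 !add0r.
have pdi l : pd i (fun z => wmetric z i l) y = 0.
  have [<-|il] := eqVneq i l.
    rewrite (_ : (fun z => _) = warp); last by apply/funext => z; rewrite wii.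
    by rewrite pdw; move: i i_lt {wii}; apply: ord4 => // _; rewrite mxE.
  rewrite (_ : (fun z => _) = fun=> 0) ?pd_cst //.
  by apply/funext => z; rewrite mxE (negbTE il) mulr0n.
rewrite /christoffel invmx_diag; last by move=> j; rewrite gt_eqF // wdiag_gt0.
rewrite (bigD1 a) //= big1 ?addr0; last first.
  by move=> l la; rewrite mxE eq_sym (negbTE la) mulr0n mul0r.
rewrite mxE eqxx mulr1n mxE !pdi add0r sub0r.
rewrite (_ : (fun z => wmetric z i i) = warp); last by apply/funext => z; rewrite wii.
by rewrite pdw; ring.
Qed.

Definition incl : 'M[R]_(2, 4) := \matrix_(i, j) (i == j :> nat)%:R.

Lemma mul_incl (x : 'rV[R]_2) : x *m incl = row4 (x 0 0) (x 0 1) 0 0.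
Proof.
apply/rowP; apply: ord4; rewrite !mxE big_ord_recr big_ord_recr big_ord0 /= !mxE /=;
  rewrite ?mulr0 ?mulr1 ?addr0 ?add0r //; congr (x 0 _); exact/val_inj.
Qed.

Lemma pd_affine_coord m n (E : 'M[R]_(m, n)) w i b :
  pd i (fun y => (y *m E + w) 0 b) = fun=> E i b.
Proof.
apply/funext => x; apply: pd_line.
have -> : (fun s => ((s *: delta_mx 0 i + x) *m E + w) 0 b) = (fun s =>
  s * E i b + (x *m E + w) 0 b).
  by apply/funext => s; rewrite mulmxDl -scalemxAl -rowE -addrA 2!mxE mxE.
apply: isD_eq; first by apply: isDD; [apply: isDM;
  [exact: isD_id|exact: isD_cst]|exact: isD_cst].
by rewrite mul1r mulr0 !addr0.
Qed.

(** For an affine map from flat space the second derivatives and the Christoffel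
    symbols of the domain vanish, and the first derivatives are the entries of
    [incl]. *)
Lemma tension_incl (H : 'rV[R]_4 -> 'M[R]_4) (v : 'rV[R]_2 -> 'rV[R]_4) (x : 'rV[R]_2) w :
  {near x, v =1 fun y => y *m incl + w} ->
  tension (fun=> 1%:M) H v x =
  \row_a (christoffel H a i0 i0 (v x) + christoffel H a i1 i1 (v x)).
Proof.
move=> vE.
have vb b : {near x, (fun y => v y 0 b) =1 fun y => (y *m incl + w) 0 b}.
  by apply: filterS vE => y ->.
have pv i b : {near x, pd i (fun y => v y 0 b) =1 fun=> incl i b}.
  by have := near_pd i (vb b); rewrite pd_affine_coord.
have pv0 i b : pd i (fun y => v y 0 b) x = incl i b by apply: (nbhs_singleton (pv i b)).
have ppv i j b : pd i (pd j (fun y => v y 0 b)) x = 0.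
  have := nbhs_singleton (near_pd i (pv j b)); by rewrite pd_cst.
apply/rowP => a; rewrite !mxE.
have S i : \sum_b \sum_c christoffel H a b c (v x) * incl i b * incl i c =
   christoffel H a (widen_ord (isT : 2 <= 4)%N i) (widen_ord (isT : 2 <= 4)%N i) (v x).
  rewrite (bigD1 (widen_ord (isT : 2 <= 4)%N i)) //= [X in _ + X]big1 ?addr0; last first.
    move=> b bi; rewrite big1 // => c _; rewrite mxE /=.
    rewrite (_ : (i == b :> nat) = false) ?mulr0 ?mul0r //.
    by apply: contra_neqF bi => /eqP ib; apply/val_inj.
  rewrite (bigD1 (widen_ord (isT : 2 <= 4)%N i)) //= [X in _ + X]big1 ?addr0; last first.
    move=> b bi; rewrite [X in _ * X]mxE /=.
    rewrite (_ : (i == b :> nat) = false) ?mulr0 //.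
    by apply: contra_neqF bi => /eqP ib; apply/val_inj.
  by rewrite !mxE eqxx !mulr1.
have T i : \sum_j invmx 1%:M i j *
   (pd i (pd j (fun y => v y 0 a)) x
    - \sum_k christoffel (fun=> 1%:M) k i j x * pd k (fun y => v y 0 a) x
    + \sum_b \sum_c christoffel H a b c (v x) * pd i (fun y => v y 0 b) x *
        pd j (fun y => v y 0 c) x) =
   christoffel H a (widen_ord (isT : 2 <= 4)%N i) (widen_ord (isT : 2 <= 4)%N i) (v x).
  rewrite invmx1 (bigD1 i) //= [X in _ + X]big1 ?addr0; last first.
    by move=> j ji; rewrite mxE eq_sym (negbTE ji) mul0r.
  rewrite mxE eqxx mul1r ppv sub0r big1 ?oppr0 ?add0r; last first.
    by move=> k _; rewrite christoffel_cst mul0r.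
  rewrite -S; apply: eq_bigr => b _; apply: eq_bigr => c _.
  by rewrite !pv0.
under eq_bigr do rewrite T.
rewrite big_ord_recr big_ord_recr big_ord0 /= add0r.
by congr (christoffel H a _ _ (v x) + christoffel H a _ _ (v x)); apply/val_inj.
Qed.
End Target.

(** * Slices of the target and their Hopf differential *)

Section AffineTorusMaps.
Context {R : realType}.

Lemma torus_continuous m (N : topologicalType) (f : torus m -> N) :
  continuous (fun x : 'rV[R]_m => f (proj x)) -> continuous f.
Proof. by move=> cf; apply/quotient_continuous. Qed.

Lemma affine_continuous m n (E : 'M[R]_(m, n)) (k : 'rV[R]_n) :
  continuous (fun x : 'rV[R]_m => x *m E + k).
Proof. by move=> x; apply: differentiable_continuous (differentiable_affine E k x). Qed.

Lemma smooth_map_affine m n (f : torus m -> torus n) (E : 'M[R]_(m, n)) (k : 'rV[R]_n) :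
  (forall x, f (proj x) = proj (x *m E + k)) ->
  smooth_map (@tatlas R m) (@tatlas R n) f.
Proof.
move=> fE; have cphi := @affine_continuous m n E k.
split=> [|_ _ p [a _ <-] [b _ <-] ap bfp].
  apply: torus_continuous.
  have -> : (fun x : 'rV[R]_m => f (proj x)) = (fun x => proj (x *m E + k)) by apply/funext.
  move=> x; apply: (@continuous_comp _ _ _ (fun x : 'rV[R]_m => x *m E + k) (@proj R n));
    first exact: cphi.
  exact: proj_continuous.
pose l := cmap (tchart b) (f p) - (cmap (tchart a) p *m E + k).
have : nbhs (cmap (tchart a) p) [set x | in_charts (tchart a) (tchart b) f x = x *m E + k
  + l].
  exact: near_lift fE cphi ap bfp.
rewrite nbhsE => -[W [oW Wp] WE].
exists W; split=> //; apply: (@eq_smooth_on _ _ _ W (fun x => x *m E + (k + l)) _ oW).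
  by move=> x; rewrite inE => /WE /= ->; rewrite addrA.
exact: smooth_on_affine.
Qed.

Lemma torus_diffeomorphism_id m : diffeomorphism (@tatlas R m) id.
Proof.
have sid : smooth_map (@tatlas R m) (@tatlas R m) id.
  by apply: (@smooth_map_affine m m id 1%:M 0) => x; rewrite mulmx1 addr0.
by exists id; split.
Qed.

(** The torus [z] fixes inside the product of two tori, parametrised by the first factor. *)
Definition slice (z : 'rV[R]_4) (p : @torus R 2) : @torus R 4 := proj (lift p *m incl + z).

Lemma slice_proj z x : slice z (proj x) = proj (x *m incl + z).
Proof.
apply/projP/lattice_eqP => j;
  rewrite mxE [(x *m incl + z) 0 j]mxE opprD addrACA subrr addr0.
rewrite !mul_incl; have /lattice_eqP xl := lift_proj x.
by move: j; apply: ord4; rewrite !mxE /= ?subrr ?rpred0 //; apply: xl.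
Qed.

Lemma slice_in_charts z a b :
  in_charts (tchart a) (tchart b) (slice z) = fun x => rep b (x *m incl + z).
Proof. by apply/funext => x; rewrite /in_charts /= slice_proj rep_lift. Qed.

Lemma slice_near z a b p : cdom (tchart a) p -> cdom (tchart b) (slice z p) ->
  {near cmap (tchart a) p, in_charts (tchart a) (tchart b) (slice z) =1 fun x => x *m incl +
     (z + (cmap (tchart b) (slice z p) - (cmap (tchart a) p *m incl + z)))}.
Proof.
move=> ap bp; have := near_lift (slice_proj z) (@affine_continuous 2 4 incl z) ap bp.
by apply: filterS => y ->; rewrite [RHS]addrA.
Qed.

Lemma smooth_slice z : smooth_map (@tatlas R 2) (@tatlas R 4) (slice z).
Proof. exact: smooth_map_affine (slice_proj z). Qed.

Lemma incl_wmetric (y : 'rV[R]_4) : incl *m wmetric y *m incl^T = (warp y)%:M :> 'M[R]_2.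
Proof.
apply/matrixP => i j; rewrite mxE (eq_bigr (fun k : 'I_4 =>
  (k == i :> nat)%:R * (wdiag y 0 k * (k == j :> nat)%:R))); last first.
  by move=> k _; rewrite mul_mx_diag !mxE [j == k :> nat]eq_sym [i == k :> nat]eq_sym mulrA.
rewrite (bigD1 (widen_ord (isT : 2 <= 4)%N i)) //= big1 ?addr0; last first.
  move=> k ki; rewrite (_ : (k == i :> nat) = false) ?mul0r //.
  by apply: contra_neqF ki => /eqP ki; apply/val_inj.
rewrite eqxx mul1r !mxE [(i == j :> nat)](_ : _ = (i == j)) // mulr_natr.
congr (_ *+ _). by case: i => [[|[|k]] Hi].
Qed.

(** A slice is homothetic: the pulled back metric is the warping constant times the
    flat metric, which is a multiple of the identity in every isothermal chart. So the two
    coordinate vectors have images that are orthogonal and of equal length. *)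
Lemma slice_hopf z : is_hopf (@tatlas R 2) (@tatlas R 4) (@warped R) (slice z)
  (@flat_metric R 2) (fun _ _ => 0).
Proof.
move=> c _ p [[sc _] gc] [b _ <-] cp bp /=; set J := jac c _ _ p; set H := warped _ _.
have ap := tlift_dom p; set a := lift p in ap.
set K := jac c (tchart a) id p.
have JE : J = K *m incl by apply: (smooth_jac_lift (slice_proj z) sc cp ap bp).
have HE : H = wmetric (lift (slice z p)) by rewrite /H /warped invariant_tensor_atlas //;
  exists b.
have KK : K *m K^T = (flat_metric c p 0 0)%:M.
  by rewrite -(gc p cp) /flat_metric (invariant_tensorE _ sc cp ap) mulmx1.
have JHJ : J *m H *m J^T = (warp (lift (slice z p)) * flat_metric c p 0 0)%:M.
  rewrite JE trmx_mul HE !mulmxA -(mulmxA K) -(mulmxA K) incl_wmetric.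
  by rewrite mul_mx_scalar -scalemxAl KK scale_scalar_mx.
have prodE i j : (row i J *m H *m (row j J)^T) 0 0 = (J *m H *m J^T) i j.
  by rewrite -row_mul [LHS]mxE [RHS]mxE; apply: eq_bigr => k _; congr (_ * _); rewrite !mxE.
have ne : (0 == 1 :> 'I_2) = false by [].
by rewrite !prodE JHJ !mxE ne !eqxx subrr mulr0n mulr0 oppr0.
Qed.

Lemma holomorphic_qdiff0 (g : tensor (@torus R 2) 2) :
  holomorphic_qdiff (@tatlas R 2) g (fun _ _ => 0).
Proof.
split=> [c d p _ _ _ _|c p _ _]; first by rewrite mul0r.
have d0 x : differentiable (fun=> 0 : R) (x : 'rV[R]_2) by apply: differentiable_cst.
by split; [exact: d0|exact: d0|rewrite /= !pd_cst|rewrite /= !pd_cst oppr0].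
Qed.

Lemma projection0 : is_projection (@tatlas R 2) (@flat_metric R 2)
  (fun _ _ => 0) (fun _ _ => 0).
Proof.
split=> [|r _]; first exact: holomorphic_qdiff0.
have [mu [amu _]] := @torus_area R; exists mu, (fun=> 0); split=> //.
- by move=> c p _ _; rewrite subrr mul0r mulr0.
- by rewrite /=; apply: integral0.
- by rewrite /=; apply: integral0.
Qed.
End AffineTorusMaps.

(** * The solution of the flow *)

Lemma continuous_add_for {R : realType} (T : topologicalType) (V : normedModType R)
    (f g : T -> V) x : {for x, continuous f} -> {for x, continuous g} ->
  {for x, continuous (fun z => f z + g z)}.
Proof. by move=> cf cg; apply: cvgD. Qed.

Section Trajectory.
Context {R : realType}.
Implicit Types (t s : R).

(** The phase of the spiral. It solves theta' = exp(- theta); the shift makes it start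
    at 5, so that the height 1/theta stays in the range where [height] is the identity. *)
Definition clock t : R := ln (t + expR 5).

Definition position t : 'rV[R]_4 := row4 0 0 (clock t / (2 * pi)) (clock t)^-1.

Lemma time_gt0 t : -1 < t -> 0 < t + expR 5.
Proof. by move=> t1; have := expR_ge1Dx (5 : R); lra. Qed.

Lemma clock_ge5 t : 0 <= t -> 5 <= clock t.
Proof.
move=> t0; rewrite /clock -{1}(expRK (5 : R)) ler_ln ?posrE ?expR_gt0 ?lerDr //.
by apply: time_gt0; lra.
Qed.

Lemma clock_gt0 t : -1 < t -> 0 < clock t.
Proof. by move=> t1; apply: ln_gt0; have := expR_ge1Dx (5 : R); lra. Qed.

Lemma expRN_clock t : -1 < t -> expR (- clock t) = (t + expR 5)^-1.
Proof. by move=> t1; rewrite expRN /clock lnK // posrE time_gt0. Qed.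

Lemma isD_clock t : -1 < t -> isD clock t (expR (- clock t)).
Proof.
move=> t1; rewrite expRN_clock //; apply: isD_eq.
  apply: (@isD_comp _ (@ln R) (fun t => t + expR 5)); first by apply: isD_ln;
    apply: time_gt0.
  by apply: isDD; [exact: isD_id|exact: isD_cst].
by rewrite addr0 mulr1.
Qed.

Definition velocity t : 'rV[R]_4 :=
  row4 0 0 (expR (- clock t) / (2 * pi)) (- (expR (- clock t) * clock t ^- 2)).

Lemma isD_position t j : -1 < t -> isD (fun s => position s 0 j) t (velocity t 0 j).
Proof.
move=> t1; have Dc := isD_clock t1; have c0 : clock t != 0 by rewrite gt_eqF // clock_gt0.
have -> : (fun s => position s 0 j) = fun s => nth 0 [:: 0; 0; clock s / (2 * pi);
  (clock s)^-1] j.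
  by apply/funext => s; rewrite mxE.
rewrite mxE; move: j; apply: ord4 => /=; [exact: isD_cst|exact: isD_cst| |].
  apply: isD_eq; first by apply: isDM; [exact: Dc|exact: isD_cst].
  by rewrite mulr0 addr0.
apply: isD_eq; first by apply: isDV; [exact: c0|exact: Dc].
by rewrite exprVn; ring.
Qed.

Lemma position_continuous t : -1 < t -> {for t, continuous position}.
Proof.
move=> t1; apply: differentiable_continuous; apply/derivable1_diffP/derivable_mxP => i j.
by rewrite ord1; have [] := isD_position j t1.
Qed.

(** A two-sided derivative, computed componentwise, gives the one-sided limit. *)
Lemma has_time_derivative_row n (f : R -> 'rV[R]_n) t (l : 'rV[R]_n) :
  (forall j, isD (fun s => f s 0 j) t (l 0 j)) -> has_time_derivative f t l.
Proof.
move=> Df; have df : derivable f t 1.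
  by apply/derivable_mxP => i j; rewrite ord1; have [] := Df j.
have dl : 'D_1 f t = l.
  by rewrite derive_mx //; apply/rowP => j; rewrite mxE; have [] := Df j.
have H : (fun h : R => h^-1 *: (f (h *: (1 : R) + t) - f t)) @ 0^' --> l by rewrite -dl;
  exact: df.
apply/cvgrPdist_lt => e e0; move/cvgrPdist_lt : H => /(_ e e0) H.
have {}H : \forall h \near (0 : R), h != 0 ->
  `|l - h^-1 *: (f (h *: (1 : R) + t) - f t)| < e.
  exact: H.
suff: \forall s \near t, s != t -> 0 <= s -> `|l - (s - t)^-1 *: (f s - f t)| < e by [].
rewrite (near_shift t) in H; apply: filterS H => s /= H st _.
have e1 : (s + (0 - t)) *: (1 : R) + t = s by rewrite [_ *: _]mulr1 sub0r subrK.
by move: H; rewrite e1 sub0r; apply; rewrite subr_eq0.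
Qed.

Lemma has_time_derivative_cst (V : normedModType R) (a : V) t :
  has_time_derivative (fun=> a) t 0.
Proof.
rewrite /has_time_derivative; under eq_fun do rewrite subrr scaler0; exact: cvg_cst.
Qed.

Definition flow t : @torus R 2 -> @torus R 4 := slice (position t).

Lemma flow_lift_coords t p b : (rep b (lift p *m incl + position t)) 0 i2 - clock t / (2
  * pi) \is a Num.int /\
  (rep b (lift p *m incl + position t)) 0 i3 - (clock t)^-1 \is a Num.int.
Proof.
have /lattice_eqP H := rep_lattice b (lift p *m incl + position t).
have := H i2; have := H i3; rewrite mul_incl.
have e (c d : R) j : (row4 (lift p 0 0) (lift p 0 1) 0 0 + row4 0 0 c d) 0 j = nth 0 [::
  lift p 0 0; lift p 0 1; c; d] j.
  by move: j; apply: ord4; rewrite !mxE /= ?add0r ?addr0.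
by rewrite /position !e.
Qed.

(** The two fibre directions contribute equally, so that the tension is minus the
    gradient of the potential; along the spiral it is the velocity. *)
Lemma flow_tension t a b p : 0 <= t -> cdom (tchart a) p -> cdom (tchart b) (flow t p) ->
  tension (local (@flat_metric R 2) (tchart a)) (local (@warped R) (tchart b))
    (in_charts (tchart a) (tchart b) (flow t)) (cmap (tchart a) p) = velocity t.
Proof.
move=> t0 ap bp; have Aa : tatlas (tchart a) by exists a.
have Ab : tatlas (tchart b) by exists b.
rewrite flat_metric_local // warped_local //.
rewrite (tension_incl _ (slice_near ap bp)); set y := in_charts _ _ _ _.
have c5 := clock_ge5 t0; set th := clock t in c5 *.
have yE : y = rep b (lift p *m incl + position t).
  by rewrite /y /in_charts /= proj_rep liftK /flow /slice rep_lift.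
clearbody y; have [/intrP[k y2] /intrP[l y3]] := flow_lift_coords t p b.
rewrite -yE in y2 y3.
have {}y2 : y 0 i2 = th / (2 * pi) + k%:~R by rewrite -y2 /th; ring.
have {}y3 : y 0 i3 = th^-1 + l%:~R by rewrite -y3 /th; ring.
have th4 : 4 <= th by lra.
have th4' : 4 < th by lra.
have D2 := potential_dx th4 y2 y3; have D3 := potential_dy th4' y2 y3.
apply/rowP => j; rewrite mxE.
rewrite (@christoffel_warped R i0 j y _ _ isT D2 D3) (@christoffel_warped R i1 j y _ _
  isT D2 D3).
have pi0 : pi != 0 :> R by rewrite gt_eqF // pi_gt0.
have h4 : 1 - height (y 0 i3) ^+ 4 != 0 by have /andP[_ h] := height4 (y 0 i3);
  rewrite gt_eqF // subr_gt0.
have th0 : th != 0 by rewrite gt_eqF //; lra.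
move: j; apply: ord4; rewrite !mxE /= /weight -/th.
- by rewrite !mulr0 addr0.
- by rewrite !mulr0 addr0.
- move: (expR _) (1 - height (y 0 i3) ^+ 4) h4 (pi : R) pi0 => E h h0 q q0; field.
  by rewrite h0 q0.
- by rewrite invr1; field.
Qed.

Lemma flow_derivative t b p : 0 <= t -> cdom (tchart b) (flow t p) ->
  has_time_derivative (fun s => cmap (tchart b) (flow s p)) t (velocity t).
Proof.
move=> t0 bp; have t1 : -1 < t by lra.
have cp : {for t, continuous (fun s => lift p *m incl + position s)}.
  apply: continuous_add_for; last exact: position_continuous.
  exact: cst_continuous.
pose k := rep b (lift p *m incl + position t) - (lift p *m incl + position t).
have H : \forall s \near t,
  rep b (lift p *m incl + position s) = lift p *m incl + position s + k.
  exact: cp _ (near_rep bp).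
apply: has_time_derivative_row => j.
have H2 : \forall s \near t,
  (lift p *m incl + position s + k) 0 j = cmap (tchart b) (flow s p) 0 j.
  by apply: filterS H => s /= Hs; rewrite rep_lift Hs.
apply: (near_eq_is_derive H2).
have -> : (fun s => (lift p *m incl + position s + k) 0 j) =
   (fun s => (lift p *m incl) 0 j + position s 0 j + k 0 j).
  by apply/funext => s; rewrite mxE [X in X + _]mxE.
apply: isD_eq.
  apply: isDD; last exact: isD_cst.
  by apply: isDD; [exact: isD_cst|exact: isD_position].
by rewrite add0r addr0.
Qed.

Lemma flow_continuous :
  {within [set z : R * @torus R 2 | 0 <= z.1], continuous (fun z => flow z.1 z.2)}.
Proof.
apply: continuous_in_subspaceT => -[t p]; rewrite inE /= => t0.
have ap := tlift_dom p; set a := lift p in ap.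
have [od _ cc _ _] := tchart_is_chart a.
have {}cc : {for p, continuous (cmap (tchart a))}.
  by move: cc; rewrite continuous_open_subspace // => /(_ p); rewrite inE => /(_ ap).
have -> : (fun z : R * @torus R 2 => flow z.1 z.2) =
    (fun z => proj (cmap (tchart a) z.2 *m incl + position z.1)).
  apply/funext => z; rewrite -(slice_proj (position z.1)) /=.
  by rewrite proj_rep liftK.
have cz : {for (t, p), continuous (fun z : R * @torus R 2 =>
  cmap (tchart a) z.2 *m incl + position z.1)}.
  apply: continuous_add_for.
    have ce : continuous (fun x : 'rV[R]_2 => x *m incl).
      have -> : (fun x : 'rV[R]_2 => x *m incl) = (fun x => x *m incl + 0 : 'rV[R]_4).
        by apply/funext => x; rewrite addr0.
      exact: affine_continuous.
    have cs : (fun z : R * @torus R 2 =>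
      cmap (tchart a) z.2) z @[z --> (t, p)] --> cmap (tchart a) p.
      by apply: (@cvg_comp _ _ _ snd (cmap (tchart a))); [exact: cvg_snd|exact: cc].
    exact: (@cvg_comp _ _ _ (fun z : R * @torus R 2 => cmap (tchart a) z.2) (fun x =>
      x *m incl) _ _ _ cs (ce _)).
  apply: (@cvg_comp _ _ _ fst position); first exact: cvg_fst.
  by apply: position_continuous => /=; lra.
have pc : {for cmap (tchart a) p *m incl + position t, continuous (@proj R 4)}.
  exact: proj_continuous.
exact: (continuous_comp cz pc).
Qed.

(** The affine expression of the flow in the charts extends to negative times greater
    than -1. *)
Lemma flow_spacetime t a b p : 0 <= t -> cdom (tchart a) p -> cdom (tchart b) (flow t p) ->
  smooth_at_spacetime (fun s =>
    in_charts (tchart a) (tchart b) (flow s)) t (cmap (tchart a) p).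
Proof.
move=> t0 ap bp; set x := cmap (tchart a) p.
pose T := [set w : 'rV[R]_(1 + 2) | -1 < w 0 (lshift 2 0)].
have oT : open T.
  rewrite openE => w /= Tw; rewrite /interior.
  by have /near_coord := near_gt Tw; apply: filterS.
pose X (w : 'rV[R]_(1 + 2)) : 'rV[R]_4 := row4 (w 0 (rshift 1 0)) (w 0 (rshift 1 1)) 0 0.
pose phi w := X w + position (w 0 (lshift 2 0)).
have sc i : smooth_on T (fun w => w 0 i) by apply: smooth_on_coord.
have cs (c : R) : @smooth_on R (1 + 2) R T (fun=> c) by apply: smooth_on_cst.
have sclock : smooth_on T (fun w => clock (w 0 (lshift 2 0))).
  apply: (smooth_on_comp (f := @ln R) oT smooth1_ln); first exact: smooth_onD.
  by move=> w /= Tw; apply: time_gt0.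
have sphi : smooth_on T phi.
  apply: smooth_onD => //; apply: smooth_on_mx => // i; rewrite ord1; apply: ord4;
    (apply: (eq_smooth_on oT); first by move=> w _; rewrite [RHS]mxE /=) => //.
    exact: (smooth_onM oT sclock (cs (2 * pi)^-1)).
  apply: (smooth_on_comp (f := fun t => t^-1) oT smooth1_inv) => // w Tw /=.
  by rewrite gt_eqF // clock_gt0.
have phiE s y : phi (row_mx s%:M y) = y *m incl + position s.
  rewrite /phi /X !row_mxEr row_mxEl mul_incl; congr (_ + position _).
  by rewrite mxE eqxx mulr1n.
pose w0 := row_mx t%:M x; have Tw0 : T w0 by rewrite /T /= row_mxEl mxE eqxx mulr1n; lra.
have bw0 : cdom (tchart b) (proj (phi w0)).
  by rewrite phiE -slice_proj /x /= proj_rep liftK.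
pose k := rep b (phi w0) - phi w0.
have cphi : {for w0, continuous phi} by apply: differentiable_continuous;
  apply: (sphi [::]).
have : nbhs w0 [set w | rep b (phi w) = phi w + k] by exact: cphi _ (near_rep bw0).
rewrite nbhsE => -[W [oW Ww0] WE].
exists (W `&` T), (fun w => phi w + k); split.
- exact: openI.
- by [].
- move=> s w [_ Tw].
  by apply: (smooth_onD oT sphi (@smooth_on_cst _ _ _ T k) s).
- by move=> s y s0 [/WE /= WE' _]; rewrite /flow slice_proj rep_lift -phiE WE'.
Qed.

(** As the Hopf differential of each slice vanishes, so does its projection, and the
    constant metric solves the second equation. *)
Lemma flow_solution (eta : R) : teichmuller_flow eta (@tatlas R 2) 1 (@tatlas R 4)
  (@warped R)
  flow (fun=> @flat_metric R 2).
Proof.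
split.
- split; first exact: flow_continuous.
    by move=> t _ _ p t0 [a _ <-] [b _ <-] ap bp; apply: flow_spacetime.
  move=> t c p t0 Ac cp; exists setT, (cst 1%:M); split=> //; first exact: openT.
    exact: smooth_on_cst.
  by move=> s x _ _; rewrite flat_metric_local.
- by move=> t _; apply: flat_in_Mc.
- move=> t _ _ p t0 [a _ <-] [b _ <-] ap bp; rewrite flow_tension //.
  exact: flow_derivative.
- move=> t t0; exists (fun _ _ => 0), (fun _ _ => 0); split.
  + exact: slice_hopf.
  + exact: projection0.
  + move=> c p _ _.
    have -> : re_dz2 (0 : R[i]) = 0.
      by apply/matrixP => i j; rewrite !mxE /= oppr0; case: ifP => // _; case: ifP.
    by rewrite scaler0; apply: has_time_derivative_cst.
Qed.
End Trajectory.

(** * The two limits *)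

Section Limits.
Context {R : realType}.

(** The difference quotients are literally the same, whether or not [f] is smooth. *)
Lemma iter_pd_addc m (V : normedModType R) (f : 'rV[R]_m -> V) (k : V) s :
  iter_pd s (fun x => f x + k) = fun x => iter_pd s f x + (if s is [::] then k else 0).
Proof.
have pdk i (c : V) (g : 'rV[R]_m -> V) : pd i (fun x => g x + c) = pd i g.
  apply/funext => x; rewrite /pd /derive.
  have -> : (fun h : R => h^-1 *: (((fun x =>
    g x + c) \o shift x) (h *: delta_mx 0 i) - (g x + c))) =
    (fun h : R => h^-1 *: ((g \o shift x) (h *: delta_mx 0 i) - g x)); last by [].
  by apply/funext => h /=; rewrite opprD addrACA subrr addr0.
case: s => // i s; rewrite /= (_ : (fun x => _ + 0) = pd i (iter_pd s f)); last first.
  by apply/funext => x; rewrite addr0.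
elim: s i => [|j s IH] i /=; first exact: pdk.
by rewrite IH.
Qed.

Definition e3 : 'rV[R]_4 := row4 0 0 0 1.

(** As the first three coordinates agree modulo the lattice, the chart expressions
    differ by the constant vector [y n *: e3] as soon as [y n] is too small to leave the
    target chart; all derivatives of positive order then agree. *)
Lemma slice_cvg (x : nat -> R) (y : nat -> R) (xoo : R) :
  (forall n, x n - xoo \is a Num.int) -> y @ \oo --> (0 : R) ->
  smooth_cvg_map (@tatlas R 2) (@tatlas R 4)
    (fun n => slice (row4 0 0 (x n) (y n))) (slice (row4 0 0 xoo 0)).
Proof.
move=> xint ycvg _ _ K [a _ <-] [b _ <-] _ _ Kb.
(* a point of K is needed to see that 0 is off the cut of the last coordinate of
   the target chart *)
have [[p0 Kp0]|K0] := pselect (exists p, K p); last first.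
  split; first by near=> n; move=> q [p Kp _]; case: K0; exists p.
  by move=> s e e0; near=> n; move=> p Kp; case: K0; exists p.
have coord z j p : (lift p *m incl + row4 0 0 z 0) 0 j = nth 0 [:: lift p 0 0;
  lift p 0 1; z; 0] j.
  by rewrite mul_incl; move: j; apply: ord4; rewrite !mxE /= ?add0r ?addr0.
have ycoord n j : (y n *: e3) 0 j = nth 0 [:: 0; 0; 0; y n] j.
  by move: j; apply: ord4; rewrite !mxE /= ?mulr0 ?mulr1.
have in0 : b 0 i3 - 2^-1 < wrap (b 0 i3) 0.
  have : (slice (row4 0 0 xoo 0) @` K) (slice (row4 0 0 xoo 0) p0) by exists p0.
  by move=> /Kb/tdom_proj/(_ i3); rewrite mxE coord /= => /andP[].
have in1 : wrap (b 0 i3) 0 < b 0 i3 + 2^-1 by have /andP[] := wrap_bounds (b 0 i3) 0.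
have near0 : \forall t \near (0 : R), wrap (b 0 i3) t = wrap (b 0 i3) 0 + t /\
    b 0 i3 - 2^-1 < wrap (b 0 i3) 0 + t < b 0 i3 + 2^-1.
  have := near_wrap in0; have := @near_in_itvoo R (b 0 i3 - 2^-1 - wrap (b 0 i3) 0)
    (b 0 i3 + 2^-1 - wrap (b 0 i3) 0) 0.
  rewrite in_itv /= subr_lt0 in0 subr_gt0 in1 => /(_ isT) H1 H2.
  apply: filterS2 H1 H2 => t; rewrite in_itv /= => /andP[h1 h2] ->.
  by split; [ring|apply/andP; split; lra].
have nearn : \forall n \near \oo, wrap (b 0 i3) (y n) = wrap (b 0 i3) 0 + y n /\
    b 0 i3 - 2^-1 < wrap (b 0 i3) 0 + y n < b 0 i3 + 2^-1 by exact: ycvg _ near0.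
have repE n : wrap (b 0 i3) (y n) = wrap (b 0 i3) 0 + y n -> forall q : 'rV[R]_2,
    rep b (q *m incl + row4 0 0 (x n) (y n)) = rep b (q *m incl + row4 0 0 xoo 0) + y n
      *: e3.
  move=> wn q; apply/rowP => j; rewrite mul_incl.
  have cj (u v : R) : (row4 (q 0 0) (q 0 1) 0 0 + row4 0 0 u v) 0 j = nth 0 [:: q 0 0;
    q 0 1; u; v] j.
    by move: j; apply: ord4; rewrite !mxE /= ?add0r ?addr0.
  rewrite mxE cj [RHS]mxE [X in X + _]mxE cj ycoord.
  by move: j {cj}; apply: ord4; rewrite /= ?addr0 //; apply: wrap_congr.
split.
  apply: filterS nearn => n [wn bn] _ [p Kp <-].
  have : (slice (row4 0 0 xoo 0) @` K) (slice (row4 0 0 xoo 0) p) by exists p.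
  move=> /Kb/tdom_proj cb; apply/tdom_proj; rewrite repE //.
  have addE (v : 'rV[R]_4) j : (v + y n *: e3) 0 j = v 0 j + nth 0 [:: 0; 0; 0; y n] j.
    by rewrite mxE ycoord.
  apply: ord4; rewrite addE ?addr0; [exact: cb i0|exact: cb i1|exact: cb i2|].
  by rewrite mxE coord.
move=> s e e0; have n1 : 0 < `|e3| + 1 by rewrite ltr_pwDr.
have small : \forall n \near \oo, `|y n| < e / (`|e3| + 1).
  have := (@cvgr0_norm_lt _ _ _ _ _ y ycvg (e / (`|e3| + 1))); apply.
  exact: divr_gt0.
apply: filterS2 nearn small => n [wn _] yn p Kp.
have -> : in_charts (tchart a) (tchart b) (slice (row4 0 0 (x n) (y n))) =
    fun q => in_charts (tchart a) (tchart b) (slice (row4 0 0 xoo 0)) q + y n *: e3.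
  by apply/funext => q; rewrite !slice_in_charts repE.
rewrite iter_pd_addc addrAC subrr add0r; case: s => [|i s]; last by rewrite normr0.
rewrite normrZ; apply: le_lt_trans (_ : `|y n| * (`|e3| + 1) < e).
  by rewrite ler_wpM2l // lerDl.
by rewrite -ltr_pdivlMr.
Unshelve. all: by end_near.
Qed.

(** Maps with values in different slices are told apart by the third coordinate,
    however the domain is reparametrised. *)
Lemma slice_inj_mod (z z' : 'rV[R]_4) p p' : slice z p = slice z' p' ->
  (z 0 i2 - z' 0 i2) \is a Num.int.
Proof.
move=> /projP/lattice_eqP/(_ i2); rewrite !mul_incl.
by rewrite [(row4 _ _ _ _ + z) 0 i2]mxE [(row4 _ _ _ _ + z') 0 i2]mxE !mxE /= !add0r.
Qed.

(** The times at which the third coordinate of the spiral is a + n + 2; the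
    shift by two makes them nonnegative. *)
Definition phase_time (a : R) (n : nat) : R := expR (2 * pi * (a + n.+2%:R)) - expR 5.

Lemma clock_phase_time a n : clock (phase_time a n) = 2 * pi * (a + n.+2%:R).
Proof. by rewrite /clock /phase_time subrK expRK. Qed.

Lemma phase_time_ge a n : 0 <= a -> n%:R <= phase_time a n.
Proof.
move=> a0; rewrite /phase_time lerBrDr.
have p2 := pi_ge2 R.
have n0 : 0 <= n%:R :> R by [].
have nE : n.+2%:R = n%:R + 2 :> R by rewrite -addn2 natrD.
have h : 5 + n%:R <= 2 * pi * (a + n.+2%:R).
  have : 4 * (a + (n%:R + 2)) <= 2 * pi * (a + (n%:R + 2)) by rewrite ler_wpM2r //; lra.
  by rewrite nE; lra.
apply: le_trans (_ : expR (5 + n%:R) <= _); last by rewrite ler_expR.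
rewrite [expR (5 + n%:R)]expRD; have := expR_ge1Dx (n%:R : R); have := expR_ge1Dx (5 : R).
move: (expR 5) (expR n%:R) => E F h1 h2.
have : E * (1 + n%:R) <= E * F by rewrite ler_wpM2l //; lra.
have : 5 * n%:R <= E * n%:R by rewrite ler_wpM2r //; lra.
by lra.
Qed.

Lemma flow_limit (a : R) : 0 <= a ->
  limit_along (@tatlas R 2) 1 (@tatlas R 4) flow (fun=> @flat_metric R 2)
    (phase_time a) (fun=> id) (slice (row4 0 0 a 0)) (@flat_metric R 2).
Proof.
move=> a0; have tn n := phase_time_ge n a0.
split.
- split=> [n|]; first exact: le_trans (tn n).
  apply/cvgryPge => A; near=> n; apply: le_trans (tn n).
  by near: n; apply: nbhs_infty_ger.
- by move=> _; apply: torus_diffeomorphism_id.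
- by split; [apply: smooth_slice|apply: flat_in_Mc].
- have pi0 : 2 * pi != 0 :> R by rewrite mulf_neq0 // gt_eqF // pi_gt0.
  have xint n : clock (phase_time a n) / (2 * pi) - a \is a Num.int.
    rewrite clock_phase_time [2 * pi * _]mulrC mulfK // [a + _]addrC addrK.
    exact: natr_int.
  apply: (slice_cvg (x := fun n => clock (phase_time a n) / (2 * pi))
    (y := fun n => (clock (phase_time a n))^-1)) => //.
  apply/cvgr0Pnorm_le => e e0; near=> n.
  have n0 : 0 < n%:R + 1 :> R by rewrite ltr_wpDl.
  have cn : n%:R + 1 <= clock (phase_time a n).
    rewrite clock_phase_time; have p2 := pi_ge2 R; have n1 : 0 <= n%:R :> R by [].
    have nE : n.+2%:R = n%:R + 2 :> R by rewrite -addn2 natrD.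
    have : 4 * (a + (n%:R + 2)) <= 2 * pi * (a + (n%:R + 2)) by rewrite ler_wpM2r //; lra.
    by rewrite nE; lra.
  rewrite ger0_norm ?invr_ge0; last by apply: le_trans cn; apply: ltW.
  apply: le_trans (_ : (n%:R + 1)^-1 <= e); first by rewrite lef_pV2 ?posrE //;
    apply: lt_le_trans cn.
  rewrite invf_ple ?posrE //; apply: le_trans (_ : n%:R <= _); last by rewrite lerDl.
  by near: n; apply: nbhs_infty_ger.
- exists (fun=> @flat_metric R 2) => [_|]; first exact: invariant_tensor_pullback.
  move=> c K _ _ _ s e e0; near=> n; move=> p _; by rewrite subrr normr0.
Unshelve. all: by end_near.
Qed.
End Limits.

Theorem corollary1p2 (R : realType) (eta : R) (eta_gt0 : 0 < eta) :
  exists (M : ptopologicalType) (A : set (chart R M 2)) (gamma : nat)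
    (N : topologicalType) (n : nat) (B : set (chart R N n)) (h : tensor N n)
    (u : R -> M -> N) (g : R -> tensor M 2)
    (t t' : nat -> R) (psi psi' : nat -> M -> M)
    (uoo uoo' : M -> N) (goo goo' : tensor M 2),
    [/\ closed_oriented_surface A gamma,
        closed_manifold B /\ riemannian_metric B h,
        teichmuller_flow eta A gamma B h u g,
        limit_along A gamma B u g t psi uoo goo
          /\ limit_along A gamma B u g t' psi' uoo' goo'
      & ~ exists f : M -> M,
          [/\ diffeomorphism A f, uoo' = uoo \o f & is_pullback A A f goo goo']].
Proof.
exists (@torus R 2), (@tatlas R 2), 1%N, (@torus R 4), 4%N, (@tatlas R 4), (@warped R),
  flow,
  (fun=> @flat_metric R 2), (phase_time 0), (phase_time 2^-1), (fun=> id), (fun=> id),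
  (slice (row4 0 0 0 0)), (slice (row4 0 0 2^-1 0)), (@flat_metric R 2), (@flat_metric R 2).
split.
- exact: torus_surface.
- by split; [apply: torus_closed|apply: warped_riemannian].
- exact: flow_solution.
- split; first exact: (@flow_limit R 0 (lexx 0)).
  have h2 : 0 <= 2^-1 :> R by rewrite invr_ge0.
  exact: (@flow_limit R 2^-1 h2).
- move=> [f [_ uf _]].
  (* otherwise 1/2 would be an integer *)
  have := congr1 (fun v => v point) uf => /slice_inj_mod.
  rewrite !mxE /= subr0 => /intrP[k kE].
  have k0 : 0%:~R < k%:~R :> R by rewrite -kE; lra.
  have k1 : k%:~R < 1%:~R :> R by rewrite -kE; lra.
  by rewrite !ltr_int in k0 k1; case: k k0 k1 {kE} => [[|k]|k].
Qed.
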